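(* For all integers $i\ge 0$ and $g\ge 0$, the functor $$\mathrm H_i(X(-);\mathbb Z)\colon \mathbf{Quiver}_{\le g}^{\mathrm{op}}\to \mathbf{Mod}_{\mathbb Z},$$ sending a quiver to the $i$-th homology of its multipath complex, is a finitely generated $\mathbf{Quiver}_{\le g}^{\mathrm{op}}$-module.
   Context: A (finite) quiver $Q$ consists of finite sets $V(Q)$ (vertices), $E(Q)$ (edges) and maps $s,t\colon E(Q)\to V(Q)$ (source, target). Its geometric realization $|Q|$ is the 1-dimensional CW complex with a 0-cell for each vertex and a 1-cell for each edge. $Q$ is connected if $|Q|$ is; the genus of $Q$ is the first Betti number of $|Q|$; a directed tree is a quiver with contractible geometric realization. A minor morphism $\phi\colon Q'\to Q$ is a map of sets $\phi\colon V(Q')\sqcup E(Q')\sqcup\{\star\}\to V(Q)\sqcup E(Q)\sqcup\{\star\}$ such that: (1) $\phi(V(Q'))=V(Q)$ and $\phi(\star)=\star$; (2) if $e\in E(Q')$ and $\phi(e)\ne\star$, then either $\phi(e)=\phi(s(e))=\phi(t(e))$ is a vertex of $Q$, or $\phi(e)$ is an edge of $Q$ with source $\phi(s(e))$ and target $\phi(t(e))$; (3) $\phi$ restricts to a bijection $\phi^{-1}(E(Q))\to E(Q)$; (4) for each vertex $v$ of $Q$, the preimage $\phi^{-1}(v)$, regarded as a subquiver of $Q'$, is a directed tree. $\mathbf{Quiver}_{\le g}$ is the category of connected finite quivers of genus at most $g$ and minor morphisms. A simple path in a quiver is a subquiver whose edges can be ordered $e_1,\dots,e_n$ such that $s(e_{i+1})=t(e_i)$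 for $i<n$; $s(e_i)=s(e_j)$ or $t(e_i)=t(e_j)$ implies $i=j$; and $s(e_1)\ne t(e_n)$. A multipath of $Q$ is a spanning subquiver (same vertex set) each of whose connected components is a single vertex or a simple path. The multipath complex $X(Q)$ is the simplicial complex whose simplices are the sets of edges of multipaths of $Q$. A minor morphism $\phi\colon Q'\to Q$ induces the simplicial map $X(Q)\to X(Q')$ sending an edge $e$ of $Q$ to the unique edge of $Q'$ mapped to $e$ by $\phi$; this makes $X$ a contravariant functor. For an essentially small category $\mathbf C$ and a ring $A$, a $\mathbf C$-module over $A$ is a functor $\mathcal M\colon\mathbf C\to A\textbf{-Mod}$. It is finitely generated if there is a finite subset $S\subseteq\bigoplus_{c}\mathcal M(c)$ (with $c$ running over objects) such that the smallest submodule (subfunctor with values $A$-submodules) of $\mathcal M$ containing $S$ is $\mathcal M$ itself. *)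

(* Defs.v *)
From HB Require Import structures.
From mathcomp Require Import all_boot all_order all_algebra.
From mathcomp Require Import generic_quotient ring_quotient.
From mathcomp Require Import all_classical all_reals topology.

Set Implicit Arguments.
Unset Strict Implicit.
Unset Printing Implicit Defensive.

Import Order.TTheory GRing.Theory Num.Theory.
Import numFieldTopology.Exports.

Local Open Scope ring_scope.
Local Open Scope quotient_scope.

(* The empty set may be a simplex; it does not contribute to the (unreduced)
   homology below. *)
Record complex (T : finType) := Complex {
  simplices :> {set {set T}};
  face_closed : forall A B : {set T},
    A \subset B -> B \in simplices -> A \in simplices
}.

Definition simplicial (S T : finType) (K : complex S) (L : complex T)
    (f : S -> T) : Prop :=
  forall A : {set S}, A \in K -> f @: A \in L.

Section Chains.
Variables (T : finType) (K : complex T).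

(* The chain complex of ordered simplices: C_n is free abelian on the tuples
   (x_0, ..., x_n), repetitions allowed, whose entries span a simplex.  It
   computes simplicial homology, and is covariant for simplicial maps without
   any choice of orientations. *)
Definition spans_simplex (n : nat) : pred (n.+1.-tuple T) :=
  fun x => [set e in x] \in K.

Definition osimplex (n : nat) := {x : n.+1.-tuple T | spans_simplex x}.

Definition chain (n : nat) := {ffun osimplex n -> int}.

Definition basis_chain n (x : osimplex n) : chain n := [ffun y => (y == x)%:R].

Definition lin_ext n (V : zmodType) (f : osimplex n -> V) (c : chain n) : V :=
  \sum_x f x *~ c x.

Lemma lin_ext_is_zmod_morphism n (V : zmodType) (f : osimplex n -> V) :
  zmod_morphism (lin_ext f).
Proof.
move=> c d; rewrite /lin_ext -sumrB; apply: eq_bigr => x _.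
by rewrite !ffunE mulrzBr.
Qed.

HB.instance Definition _ n (V : zmodType) (f : osimplex n -> V) :=
  GRing.isZmodMorphism.Build (chain n) V (lin_ext f)
    (lin_ext_is_zmod_morphism f).

Lemma lin_ext_basis n (V : zmodType) (f : osimplex n -> V) x :
  lin_ext f (basis_chain x) = f x.
Proof.
rewrite /lin_ext (bigD1 x) //= ffunE eqxx big1 ?addr0 // => y yx.
by rewrite ffunE (negbTE yx).
Qed.

Lemma lin_ext_comp n (V W : zmodType) (g : {additive V -> W})
    (f : osimplex n -> V) c :
  g (lin_ext f c) = lin_ext (g \o f) c.
Proof. by rewrite raddf_sum; apply: eq_bigr => x _; rewrite raddfMz. Qed.

Lemma eq_lin_ext n (V : zmodType) (f g : osimplex n -> V) c :
  f =1 g -> lin_ext f c = lin_ext g c.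
Proof. by move=> fg; apply: eq_bigr => x _; rewrite fg. Qed.

Lemma chain_basis n (c : chain n) : c = lin_ext (@basis_chain n) c.
Proof.
apply/ffunP => y; rewrite /lin_ext sum_ffunE (bigD1 y) //= big1 => [|x xy].
  by rewrite addr0 ffunMzE ffunE eqxx intz.
by rewrite ffunMzE ffunE eq_sym (negbTE xy) mul0rz.
Qed.

Lemma face_subproof n (j : 'I_n.+2) (x : osimplex n.+1) :
  spans_simplex [tuple tnth (val x) (lift j i) | i < n.+1].
Proof.
rewrite /spans_simplex; apply: face_closed (valP x); apply/fintype.subsetP => e; rewrite !inE.
by case/tnthP => i ->; rewrite tnth_mktuple mem_tnth.
Qed.

Definition face n (j : 'I_n.+2) (x : osimplex n.+1) : osimplex n :=
  Sub _ (face_subproof j x).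

Definition boundary n : chain n.+1 -> chain n :=
  lin_ext (fun x => \sum_(j < n.+2) basis_chain (face j x) *~ (-1) ^+ j).

HB.instance Definition _ n := GRing.Additive.on (@boundary n).

Definition is_cycle n : chain n -> bool :=
  match n with 0 => xpredT | m.+1 => fun c => boundary c == 0 end.

Lemma is_cycle_zmod_closed n : zmod_closed (@is_cycle n).
Proof.
case: n => [|n]; split => //; first by rewrite unfold_in /= raddf0.
by move=> c d; rewrite !unfold_in /= => /eqP bc /eqP bd; rewrite raddfB /= bc bd subrr.
Qed.

HB.instance Definition _ n :=
  GRing.isZmodClosed.Build (chain n) (@is_cycle n) (is_cycle_zmod_closed n).

Record cycles n := Cycle { cycle_chain :> chain n; _ : is_cycle cycle_chain }.

HB.instance Definition _ n := [isSub for @cycle_chain n].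
HB.instance Definition _ n := [Choice of cycles n by <:].
HB.instance Definition _ n := [SubChoice_isSubZmodule of cycles n by <:].

Definition is_boundary n : cycles n -> bool :=
  fun z => `[< exists c : chain n.+1, val z = boundary c >].

Lemma is_boundary_zmod_closed n : zmod_closed (@is_boundary n).
Proof.
split; first by rewrite unfold_in; apply/asboolP; exists 0; rewrite !raddf0.
move=> y z; rewrite !unfold_in => /asboolP[c yc] /asboolP[d zd].
by apply/asboolP; exists (c - d); rewrite !raddfB /= yc zd.
Qed.

Definition boundaries n : zmodClosed (cycles n) :=
  HB.pack (@is_boundary n) (GRing.isZmodClosed.Build (cycles n)
    (@is_boundary n) (is_boundary_zmod_closed n)).

Definition homology n : zmodType := Quotient.quot (boundaries n).

Definition homology_class n : cycles n -> homology n := \pi.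

End Chains.

Section InducedMap.
Variables (S T : finType) (K : complex S) (L : complex T) (f : S -> T).
Hypothesis fKL : simplicial K L f.

Lemma osimplex_map_subproof n (x : osimplex K n) :
  spans_simplex L [tuple f (tnth (val x) i) | i < n.+1].
Proof.
rewrite /spans_simplex (_ : [set e in _] = f @: [set e in val x]).
  exact: fKL (valP x).
apply/setP => e; rewrite inE; apply/tnthP/imsetP => [[i ->]|[d]].
  by exists (tnth (val x) i); rewrite ?inE ?mem_tnth ?tnth_mktuple.
by rewrite inE => /tnthP[i ->] ->; exists i; rewrite tnth_mktuple.
Qed.

Definition osimplex_map n (x : osimplex K n) : osimplex L n :=
  Sub _ (osimplex_map_subproof x).

Definition chain_map n : chain K n -> chain L n :=
  lin_ext (fun x => basis_chain (osimplex_map x)).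

HB.instance Definition _ n := GRing.Additive.on (@chain_map n).

Lemma osimplex_map_face n j (x : osimplex K n.+1) :
  osimplex_map (face j x) = face j (osimplex_map x).
Proof.
apply: val_inj; apply: eq_from_tnth => i.
by rewrite !tnth_mktuple.
Qed.

Lemma chain_map_boundary n (c : chain K n.+1) :
  chain_map (boundary c) = boundary (chain_map c).
Proof.
rewrite {1}/boundary {2}/chain_map !lin_ext_comp; apply: eq_lin_ext => x /=.
rewrite /boundary lin_ext_basis raddf_sum; apply: eq_bigr => j _ /=.
by rewrite raddfMz /= /chain_map lin_ext_basis osimplex_map_face.
Qed.

Lemma cycle_map_subproof n (z : cycles K n) : is_cycle (chain_map (val z)).
Proof.
case: n z => [//|n] z /=; rewrite -chain_map_boundary.
by have /eqP-> := valP z; rewrite raddf0.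
Qed.

Definition cycle_map n (z : cycles K n) : cycles L n :=
  Cycle (cycle_map_subproof z).

Lemma cycle_map_is_zmod_morphism n : zmod_morphism (@cycle_map n).
Proof. by move=> y z; apply: val_inj; rewrite /= !raddfB. Qed.

HB.instance Definition _ n :=
  GRing.isZmodMorphism.Build (cycles K n) (cycles L n) (@cycle_map n)
    (@cycle_map_is_zmod_morphism n).

Definition homology_map n (h : homology K n) : homology L n :=
  homology_class (cycle_map (repr h)).

Lemma homology_mapE n (z : cycles K n) :
  homology_map (homology_class z) = homology_class (cycle_map z).
Proof.
apply/eqP; rewrite -Quotient.idealrBE -raddfB.
have: repr (homology_class z) - z \in boundaries K n.
  by rewrite Quotient.idealrBE; apply/eqP; rewrite reprK.
move=> /asboolP[c zc]; apply/asboolP; exists (chain_map c) => /=.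
by rewrite -chain_map_boundary -zc.
Qed.

Lemma homology_map_is_zmod_morphism n : zmod_morphism (@homology_map n).
Proof.
move=> a b; rewrite -[a]reprK -[b]reprK -raddfB.
by rewrite !homology_mapE /= /homology_class !raddfB.
Qed.

HB.instance Definition _ n :=
  GRing.isZmodMorphism.Build (homology K n) (homology L n) (@homology_map n)
    (@homology_map_is_zmod_morphism n).

End InducedMap.

Lemma homology_map_id (T : finType) (K : complex T) (f : T -> T)
    (fK : simplicial K K f) n :
  f =1 id -> homology_map fK (n := n) =1 id.
Proof.
move=> fid h; rewrite -[h]reprK homology_mapE; congr homology_class.
apply: val_inj; rewrite /= [RHS]chain_basis; apply: eq_lin_ext => x.
congr basis_chain; apply: val_inj; apply: eq_from_tnth => i.
by rewrite tnth_mktuple fid.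
Qed.

Lemma homology_map_comp (S T U : finType)
    (K : complex S) (L : complex T) (M : complex U)
    (f : S -> T) (g : T -> U) (h : S -> U) (fKL : simplicial K L f)
    (gLM : simplicial L M g) (hKM : simplicial K M h) n :
  h =1 g \o f ->
  homology_map hKM (n := n) =1 homology_map gLM (n := n) \o homology_map fKL (n := n).
Proof.
move=> hgf a; have [z <-] : exists z, homology_class z = a.
  by exists (repr a); exact: reprK.
rewrite /= !homology_mapE; congr homology_class.
apply: val_inj; rewrite /= /chain_map lin_ext_comp; apply: eq_lin_ext => x /=.
rewrite lin_ext_basis; congr basis_chain; apply: val_inj.
by apply: eq_from_tnth => i; rewrite !tnth_mktuple hgf.
Qed.

Record quiver := Quiver {
  vert : finType;
  edge : finType;
  src : edge -> vert;
  tgt : edge -> vert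
}.

Record subquiver (Q : quiver) := Subquiver {
  sub_vert : {set vert Q};
  sub_edge : {set edge Q};
  sub_src : forall e, e \in sub_edge -> src e \in sub_vert;
  sub_tgt : forall e, e \in sub_edge -> tgt e \in sub_vert
}.

Definition quiver_of_sub (Q : quiver) (P : subquiver Q) : quiver :=
  @Quiver {v | v \in sub_vert P} {e | e \in sub_edge P}
    (fun e => exist (fun v => v \in sub_vert P) _ (sub_src (valP e)))
    (fun e => exist (fun v => v \in sub_vert P) _ (sub_tgt (valP e))).

Coercion quiver_of_sub : subquiver >-> quiver.

Definition unit_interval (R : realType) : topologicalType :=
  set_type (`[0%R, 1%R]%classic : set R).

Lemma itv0_subproof (R : realType) : (0 : R) \in `[0%R, 1%R]%classic.
Proof. by rewrite inE /= in_itv /= lexx ler01. Qed.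

Lemma itv1_subproof (R : realType) : (1 : R) \in `[0%R, 1%R]%classic.
Proof. by rewrite inE /= in_itv /= lexx ler01. Qed.

Definition itv0 (R : realType) : unit_interval R :=
  exist (fun x : R => x \in `[0%R, 1%R]%classic) _ (itv0_subproof R).

Definition itv1 (R : realType) : unit_interval R :=
  exist (fun x : R => x \in `[0%R, 1%R]%classic) _ (itv1_subproof R).

Section Realization.
Variables (R : realType) (Q : quiver).

Definition cell (c : vert Q + edge Q) : topologicalType :=
  match c with inl _ => discrete_topology unit | inr _ => unit_interval R end.

(* |Q| is the quotient of the disjoint union of the cells that identifies the
   endpoints 0 and 1 of the 1-cell of e with the 0-cells of src e and tgt e;
   attach sends a point of a cell to the 0-cell it is glued to, if any. *)
Definition attach (p : {c & cell c}) : vert Q + {c & cell c} :=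
  match p with
  | existT (inl v) _ => inl v
  | existT (inr e) x as p' =>
      if x == itv0 R then inl (src e)
      else if x == itv1 R then inl (tgt e) else inr p'
  end.

Definition glued : rel {c & cell c} := fun p q => attach p == attach q.

Lemma glued_refl : reflexive glued.
Proof. by move=> p; rewrite /glued. Qed.

Lemma glued_sym : symmetric glued.
Proof. by move=> p q; rewrite /glued eq_sym. Qed.

Lemma glued_trans : transitive glued.
Proof. by move=> q p r; rewrite /glued => /eqP->. Qed.

Definition glued_equiv := EquivRel glued glued_refl glued_sym glued_trans.

Definition realization : topologicalType :=
  quotient_topology {eq_quot glued_equiv}.

End Realization.

Definition contractible (R : realType) (T : topologicalType) : Prop :=
  exists (x0 : T) (H : (T * unit_interval R)%type -> T),
    [/\ continuous H,
        forall x, H (x, itv0 R) = x &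
        forall x, H (x, itv1 R) = x0].

Definition quiver_connected (R : realType) (Q : quiver) : Prop :=
  connected [set: realization R Q].

Definition directed_tree (R : realType) (Q : quiver) : Prop :=
  contractible R (realization R Q).

(* The cellular boundary C_1(|Q|) -> C_0(|Q|), acting on row vectors. *)
Definition cellular_boundary (Q : quiver) : 'M[rat]_(#|edge Q|, #|vert Q|) :=
  \matrix_(e, v) ((tgt (enum_val e) == enum_val v)%:R
                  - (src (enum_val e) == enum_val v)%:R).

(* The first Betti number of |Q|: a 1-dimensional CW complex has no 2-cells, so
   its first rational homology is the kernel of the cellular boundary. *)
Definition genus (Q : quiver) : nat := \rank (kermx (cellular_boundary Q)).

(* None is the extra point. *)
Definition elt (Q : quiver) : Type := option (vert Q + edge Q).

Definition of_vert (Q : quiver) (v : vert Q) : elt Q := Some (inl v).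

Definition of_edge (Q : quiver) (e : edge Q) : elt Q := Some (inr e).

Definition is_minor (R : realType) (Q' Q : quiver) (phi : elt Q' -> elt Q) :
    Prop :=
  [/\ (phi @` range (@of_vert Q') = range (@of_vert Q))%classic
        /\ phi None = None,
      forall e' : edge Q', phi (of_edge e') <> None ->
        (exists v : vert Q,
          [/\ phi (of_edge e') = of_vert v,
              phi (of_vert (src e')) = of_vert v &
              phi (of_vert (tgt e')) = of_vert v])
        \/ (exists e : edge Q,
          [/\ phi (of_edge e') = of_edge e,
              phi (of_vert (src e')) = of_vert (src e) &
              phi (of_vert (tgt e')) = of_vert (tgt e)]),
      forall e : edge Q, exists! x : elt Q', phi x = of_edge e &
      forall v : vert Q, exists P : subquiver Q',
        [/\ forall w, (w \in sub_vert P) = (phi (of_vert w) == of_vert v),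
            forall e, (e \in sub_edge P) = (phi (of_edge e) == of_vert v) &
            directed_tree R P]].

Record minor (R : realType) (Q' Q : quiver) := Minor {
  minor_fun :> elt Q' -> elt Q;
  minorP : is_minor R minor_fun
}.

Section Multipath.
Variable Q : quiver.

Definition adjacent (P : subquiver Q) : rel (vert Q) := fun v w =>
  [exists e in sub_edge P,
    ((src e == v) && (tgt e == w)) || ((src e == w) && (tgt e == v))].

Lemma adjacent_sym P : symmetric (adjacent P).
Proof. by move=> v w; apply: eq_existsb => e; rewrite orbC. Qed.

Lemma adjacent_edge P e : e \in sub_edge P -> adjacent P (src e) (tgt e).
Proof. by move=> eP; apply/existsP; exists e; rewrite eP !eqxx. Qed.

Definition component_vert P v := [set w | connect (adjacent P) v w].

Definition component_edge P v := [set e in sub_edge P | src e \in component_vert P v].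

Lemma component_src P v e :
  e \in component_edge P v -> src e \in component_vert P v.
Proof. by rewrite inE => /andP[]. Qed.

Lemma component_tgt P v e :
  e \in component_edge P v -> tgt e \in component_vert P v.
Proof.
rewrite !inE => /andP[eP /connect_trans]; apply.
exact/connect1/adjacent_edge.
Qed.

Definition component P v : subquiver Q :=
  Subquiver (@component_src P v) (@component_tgt P v).

Definition single_vertex (P : subquiver Q) : Prop :=
  (exists v, sub_vert P = [set v]) /\ sub_edge P = finset.set0.

Definition follows : rel (edge Q) := fun e f => src f == tgt e.

Definition simple_path (P : subquiver Q) : Prop :=
  exists (e1 : edge Q) (es : seq (edge Q)),
    [/\ e1 :: es =i sub_edge P,
        path follows e1 es,
        uniq (map (@src Q) (e1 :: es)),
        uniq (map (@tgt Q) (e1 :: es)) &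
        src e1 != tgt (last e1 es)].

Definition multipath (P : subquiver Q) : Prop :=
  sub_vert P = [set: vert Q] /\
  forall v, single_vertex (component P v) \/ simple_path (component P v).

Definition multipath_simplices : {set {set edge Q}} :=
  [set A | `[< exists P, multipath P /\ sub_edge P = A >]].

(* A combinatorial criterion, used to see that X(Q) is a complex and that minor
   morphisms induce simplicial maps. *)
Definition linear_edges (A : {set edge Q}) : Prop :=
  [/\ {in A &, injective (@src Q)}, {in A &, injective (@tgt Q)} &
      forall e1 es, {subset e1 :: es <= A} -> path follows e1 es ->
        src e1 != tgt (last e1 es)].

Lemma uniq_map_inj (T U : eqType) (f : T -> U) (s : seq T) :
  uniq (map f s) -> {in s &, injective f}.
Proof.
elim: s => [|x s IHs] //= /andP[fx us] y z; rewrite !inE.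
case/predU1P=> [->|ys] /predU1P[->|zs] // fyz.
- by rewrite fyz map_f in fx.
- by rewrite -fyz map_f in fx.
- exact: IHs.
Qed.

Lemma follows_component P v e f : f \in sub_edge P -> follows e f ->
  e \in component_edge P v -> f \in component_edge P v.
Proof.
move=> fP /eqP ef ev; rewrite inE fP ef /=.
exact: component_tgt.
Qed.

Lemma path_component P v e es :
  {subset e :: es <= sub_edge P} -> path follows e es ->
  e \in component_edge P v -> {subset e :: es <= component_edge P v}.
Proof.
elim: es e => [|f es IHes] e sP /=.
  by move=> _ ev g; rewrite inE => /eqP->.
case/andP=> ef fes ev g; rewrite inE => /predU1P[->//|].
apply: IHes => //; first by move=> h hes; apply: sP; rewrite inE hes orbT.
by apply: (follows_component _ ef ev); apply: sP; rewrite !inE eqxx orbT.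
Qed.

Lemma edge_component P e :
  e \in sub_edge P -> e \in component_edge P (src e).
Proof. by move=> eP; rewrite !inE eP connect0. Qed.

Lemma simple_path_index (e1 : edge Q) es f g :
  path follows e1 es -> uniq (map (@src Q) (e1 :: es)) ->
  uniq (map (@tgt Q) (e1 :: es)) -> src e1 != tgt (last e1 es) ->
  f \in e1 :: es -> g \in e1 :: es -> follows f g ->
  index g (e1 :: es) = (index f (e1 :: es)).+1.
Proof.
move=> pes us ut ends fp gp /eqP fg; set p := e1 :: es in us ut fp gp *.
have up : uniq p := map_uniq us.
have nextP i : (i.+1 < size p)%N -> src (nth e1 p i.+1) = tgt (nth e1 p i).
  by rewrite /p /= ltnS => ilt; move/pathP: pes => /(_ e1 i ilt) /eqP.
have fE := nth_index e1 fp; have gE := nth_index e1 gp.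
have flt : (index f p < size p)%N by rewrite index_mem.
have glt : (index g p < size p)%N by rewrite index_mem.
case gi: (index g p) => [|j].
  rewrite gi /= in gE; have [lt|ge] := ltnP (index f p).+1 (size p).
    have : nth e1 p (index f p).+1 = e1.
      apply: (uniq_map_inj us); rewrite ?mem_nth ?mem_head //.
      by rewrite nextP // fE gE.
    by move/(congr1 (index^~ p)); rewrite index_uniq //= eqxx.
  have sp : size p = (size es).+1 by [].
  have fl : index f p = (size p).-1.
    by rewrite sp !ltnS in flt ge *; apply/eqP; rewrite eqn_leq flt.
  have fl' : f = last e1 es by rewrite -fE fl nth_last.
  by case/eqP: ends; rewrite -fl' -fg -gE.
have : nth e1 p j = f.
  apply: (uniq_map_inj ut); rewrite ?mem_nth //.
    by apply: ltnW; rewrite -gi.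
  by rewrite -nextP -?gi // gE fg.
by move=> <-; rewrite index_uniq //; apply: ltnW; rewrite -gi.
Qed.

Lemma multipath_linear P : multipath P -> linear_edges (sub_edge P).
Proof.
case=> _ compP.
have spP e : e \in sub_edge P -> simple_path (component P (src e)).
  move=> eP; case: (compP (src e)) => // -[_] /= c0.
  by have := edge_component eP; rewrite c0 inE.
split=> [e f eP fP ef|e f eP fP ef|e es sP pes].
- have [e1 [es [esE _ us _ _]]] := spP e eP.
  apply: (uniq_map_inj us _ _ ef); rewrite esE ?edge_component //=.
  by rewrite ef edge_component.
- have [e1 [es [esE _ _ ut _]]] := spP e eP.
  apply: (uniq_map_inj ut _ _ ef); rewrite esE ?edge_component //=.
  rewrite !inE fP /=; apply: (@connect_trans _ _ (tgt e)).
    exact/connect1/adjacent_edge.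
  by rewrite ef; apply/connect1; rewrite adjacent_sym adjacent_edge.
have eP : e \in sub_edge P by apply: sP; rewrite mem_head.
have sub := path_component sP pes (edge_component eP).
have [e1 [p [pE pp us ut ends]]] := spP e eP.
have idx := simple_path_index pp us ut ends.
have {}sub : {subset e :: es <= e1 :: p} by move=> x /sub; rewrite pE.
apply/negP => cyc; have le : (index e (e1 :: p) <= index (last e es) (e1 :: p))%N.
  elim: es e {sP eP pE cyc spP} pes sub => [|f es IHes] e //= /andP[ef pes] sub.
  have sub' : {subset f :: es <= e1 :: p}.
    by move=> x xs; apply: sub; rewrite inE xs orbT.
  apply: leq_trans (IHes _ pes sub'); rewrite (idx e f) //; apply: sub.
    exact: mem_head.
  by rewrite !inE eqxx orbT.
have := idx (last e es) e; rewrite (sub e (mem_head _ _)) (sub _ (mem_last _ _)).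
by move=> /(_ isT isT cyc) E; rewrite E ltnn in le.
Qed.

Lemma linear_uniq (A : {set edge Q}) e es : linear_edges A ->
  {subset e :: es <= A} -> path follows e es -> uniq (e :: es).
Proof.
move=> [_ _ acyc]; elim: es e => [|f es IHes] e // sA pes.
rewrite cons_uniq IHes; last by case/andP: pes.
  rewrite andbT; apply/negP; move: pes sA; move: (f :: es) => {IHes f}es + + ees.
  case/splitPr: ees => p1 p2; rewrite cat_path /= => /and3P[pp1 fol _] sA.
  suff /negP[] : src e != tgt (last e p1) by [].
  apply: acyc pp1 => x; rewrite inE => xp; apply: sA.
  by rewrite inE mem_cat; case/orP: xp => ->; rewrite ?orbT.
by move=> x xs; apply: sA; rewrite inE xs orbT.
Qed.

Lemma linear_multipath P : sub_vert P = [set: vert Q] ->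
  linear_edges (sub_edge P) -> multipath P.
Proof.
move=> PT lin; split=> // v; have [src_inj tgt_inj acyc] := lin.
have csym : connect_sym (adjacent P) := sym_connect_sym (adjacent_sym P).
have [c0|[e0 e0c]] := set_0Vmem (component_edge P v).
  left; split=> //; exists v; apply/setP => w; rewrite !inE.
  apply/idP/eqP => [/connectP[[|u p] //= /andP[vu _] _]|->]; last exact: connect0.
  case/existsP: vu => e /andP[eP evu].
  suff : e \in component_edge P v by rewrite c0 inE.
  rewrite !inE eP /=; case/orP: evu => /andP[/eqP a /eqP b].
    by rewrite a connect0.
  by rewrite csym -b; apply/connect1/adjacent_edge.
right.
pose good n := `[< exists e1 es, [/\ size es = n, {subset e1 :: es <= sub_edge P},
  path follows e1 es & src e1 \in component_vert P v] >].
have exg : exists n, good n.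
  exists 0; apply/asboolP; exists e0, [::]; move: (e0c); rewrite inE => /andP[e0P e0v].
  by split=> // x; rewrite inE => /eqP->.
have ubg n : good n -> (n <= #|edge Q|)%N.
  move=> /asboolP[e1 [es [<- sP pes _]]]; apply: leq_trans (leqnSn _) _.
  by have /card_uniqP /= <- := linear_uniq lin sP pes; exact: max_card.
case: (ex_maxnP exg ubg) => n /asboolP[e1 [es [szes sP pes e1v]]] maxn.
have max1 e1' es' : {subset e1' :: es' <= sub_edge P} -> path follows e1' es' ->
    src e1' \in component_vert P v -> (size es' <= size es)%N.
  by move=> *; rewrite szes; apply: maxn; apply/asboolP; exists e1', es'; split.
have e1P : e1 \in sub_edge P by apply: sP; exact: mem_head.
have nextP i : (i < size es)%N -> src (nth e1 es i) = tgt (nth e1 (e1 :: es) i).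
  by move=> ilt; move/pathP: pes => /(_ e1 i ilt) /eqP.
pose W := [set w | has (fun f => (src f == w) || (tgt f == w)) (e1 :: es)].
have WP e : e \in sub_edge P -> (src e \in W) || (tgt e \in W) -> e \in e1 :: es.
  move=> eP; have sg g : g \in e1 :: es -> src g = src e -> e \in e1 :: es.
    by move=> gp ge; rewrite -(src_inj _ _ (sP g gp) eP ge).
  have tg g : g \in e1 :: es -> tgt g = tgt e -> e \in e1 :: es.
    by move=> gp ge; rewrite -(tgt_inj _ _ (sP g gp) eP ge).
  rewrite !inE -!/(is_true _); case/orP => /hasP[f fp /orP[/eqP fe|/eqP fe]].
  - exact: sg fp fe.
  - have flt : (index f (e1 :: es) < size (e1 :: es))%N by rewrite index_mem.
    have [lt|ge] := ltnP (index f (e1 :: es)) (size es).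
      apply: (sg (nth e1 es (index f (e1 :: es)))).
        by rewrite inE mem_nth ?orbT.
      by rewrite nextP // nth_index.
    have fl : f = last e1 es.
      rewrite -(nth_index e1 fp) (_ : index f _ = size es) ?nth_last //.
      by apply/eqP; rewrite eqn_leq ge -ltnS flt.
    suff : (size (rcons es e) <= size es)%N by rewrite size_rcons ltnn.
    apply: (max1 e1) => //.
      move=> x; rewrite inE mem_rcons inE orbCA => /predU1P[->//|xp].
      by apply: sP; rewrite inE.
    by rewrite rcons_path pes /= /follows -fl fe.
  - have [i0|igt] := posnP (index f (e1 :: es)).
      have fe1 : f = e1 by rewrite -(nth_index e1 fp) i0.
      suff : (size (e1 :: es) <= size es)%N by rewrite /= ltnn.
      apply: (max1 e); first by move=> x; rewrite inE => /predU1P[->//|/sP].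
        by rewrite /= pes andbT /follows -fe1 fe.
      move: e1v; rewrite !inE => /connect_trans; apply.
      by rewrite -fe1 fe csym; apply/connect1/adjacent_edge.
    apply: (tg (nth e1 (e1 :: es) (index f (e1 :: es)).-1)).
      by apply: mem_nth; rewrite prednK // ltnW // index_mem.
    rewrite -nextP; last by rewrite -ltnS prednK // index_mem.
    rewrite -fe -{2}(nth_index e1 fp).
    by case: (index f (e1 :: es)) igt.
  - exact: tg fp fe.
have clW w : connect (adjacent P) (src e1) w -> w \in W.
  case/connectP => p; have : src e1 \in W by rewrite inE /= eqxx.
  elim: p (src e1) => [|u p IHp] x xW /=; first by move=> _ ->.
  case/andP=> /existsP[e /andP[eP exu]]; apply: IHp.
  have ep : e \in e1 :: es.
    by apply: WP => //; case/orP: exu => /andP[/eqP a /eqP b]; rewrite ?a ?b xW ?orbT.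
  rewrite inE; apply/hasP; exists e => //.
  by case/orP: exu => /andP[/eqP-> /eqP->]; rewrite eqxx ?orbT.
have up := linear_uniq lin sP pes.
exists e1, es; split=> //.
- move=> e; apply/idP/idP => [ep|].
    apply: (path_component sP pes) => //.
    by rewrite inE e1P.
  rewrite inE => /andP[eP]; rewrite inE => ve; apply: WP => //.
  rewrite clW // csym; apply: connect_trans (_ : connect _ v _).
    by rewrite csym.
  by move: e1v; rewrite inE.
- by rewrite map_inj_in_uniq // => x y /sP xP /sP; exact: src_inj.
- by rewrite map_inj_in_uniq // => x y /sP xP /sP; exact: tgt_inj.
- exact: acyc.
Qed.

Definition spanning (A : {set edge Q}) : subquiver Q :=
  @Subquiver Q [set: vert Q] A (fun e _ => finset.in_setT (src e))
    (fun e _ => finset.in_setT (tgt e)).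

Lemma multipath_simplicesP A :
  reflect (linear_edges A) (A \in multipath_simplices).
Proof.
rewrite inE; apply: (iffP (asboolP _)) => [[P [mP <-]]|lin].
  exact: multipath_linear.
by exists (spanning A); split=> //; exact: linear_multipath.
Qed.

Lemma multipath_face_closed (A B : {set edge Q}) : A \subset B ->
  B \in multipath_simplices -> A \in multipath_simplices.
Proof.
move=> /fintype.subsetP AB /multipath_simplicesP[si ti ac].
apply/multipath_simplicesP; split=> [e f /AB eB /AB|e f /AB eB /AB|e es sA].
- exact: si.
- exact: ti.
- by apply: ac => x /sA /AB.
Qed.

Definition multipath_complex : complex (edge Q) :=
  Complex multipath_face_closed.

End Multipath.

Section MinorEdges.
Variables (R : realType) (Q' Q : quiver) (phi : minor R Q' Q).

Lemma edge_lift_subproof (e : edge Q) :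
  exists e' : edge Q', phi (of_edge e') == of_edge e.
Proof.
have [[vE starE] _ /(_ e)[x [xE _]] _] := minorP phi.
case: x xE => [[v|e']|] xE; last by rewrite starE in xE.
  have : ((phi @` range (@of_vert Q')) (phi (of_vert v)))%classic.
    by exists (of_vert v) => //; exists v.
  by rewrite vE xE => -[w _].
by exists e'; apply/eqP.
Qed.

(* The unique edge of Q' that phi maps to e. *)
Definition edge_lift (e : edge Q) : edge Q' := xchoose (edge_lift_subproof e).

Lemma edge_liftE e : phi (of_edge (edge_lift e)) = of_edge e.
Proof. by apply/eqP; exact: xchooseP (edge_lift_subproof e). Qed.

Lemma edge_lift_unique e e' : phi (of_edge e') = of_edge e -> edge_lift e = e'.
Proof.
move=> e'E; have [_ _ /(_ e)[x [_ ux]] _] := minorP phi.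
have : of_edge (edge_lift e) = of_edge e'.
  by rewrite -(ux _ (edge_liftE e)) -(ux _ e'E).
by case.
Qed.

Lemma edge_lift_src_tgt e :
  phi (of_vert (src (edge_lift e))) = of_vert (src e) /\
  phi (of_vert (tgt (edge_lift e))) = of_vert (tgt e).
Proof.
have [_ /(_ (edge_lift e)) + _ _] := minorP phi.
rewrite edge_liftE => /(_ ltac:(by []))[[v []] //|[f [[ef] -> ->]]].
by rewrite ef.
Qed.

Lemma edge_lift_simplicial :
  simplicial (multipath_complex Q) (multipath_complex Q') edge_lift.
Proof.
move=> A /multipath_simplicesP[si ti ac]; apply/multipath_simplicesP.
have srcI e f : src (edge_lift e) = src (edge_lift f) -> src e = src f.
  have [+ _] := edge_lift_src_tgt e; have [+ _] := edge_lift_src_tgt f.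
  by move=> + + ef; rewrite ef => -> [].
have tgtI e f : tgt (edge_lift e) = tgt (edge_lift f) -> tgt e = tgt f.
  have [_ +] := edge_lift_src_tgt e; have [_ +] := edge_lift_src_tgt f.
  by move=> + + ef; rewrite ef => -> [].
have srctgt e f : src (edge_lift e) = tgt (edge_lift f) -> src e = tgt f.
  have [+ _] := edge_lift_src_tgt e; have [_ +] := edge_lift_src_tgt f.
  by move=> + + ef; rewrite ef => -> [].
split=> [_ _ /imsetP[e eA ->] /imsetP[f fA ->] /srcI ef|
         _ _ /imsetP[e eA ->] /imsetP[f fA ->] /tgtI ef|e1' es' sA pes].
- by rewrite (si e f).
- by rewrite (ti e f).
have [s sE] : exists s, e1' :: es' = map edge_lift s /\ {subset s <= A}.
  elim: (e1' :: es') sA => [|e' s IHs] sA; first by exists [::].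
  have [|t [-> tA]] := IHs; first by move=> x xs; apply: sA; rewrite inE xs orbT.
  have /imsetP[e eA ->] := sA e' (mem_head _ _).
  by exists (e :: t); split=> // x; rewrite inE => /predU1P[->//|/tA].
case: s sE pes => [[]//|e1 es] [[-> ->] esA]; rewrite path_map last_map => pes.
apply/eqP => /srctgt /eqP; apply/negP; apply: ac => //.
by apply: sub_path pes => e f /eqP /srctgt /eqP.
Qed.

End MinorEdges.

Record quiver_le (R : realType) (g : nat) := QuiverLe {
  quiver_le_quiver :> quiver;
  quiver_le_connected : quiver_connected R quiver_le_quiver;
  quiver_le_genus : (genus quiver_le_quiver <= g)%N
}.

(* A functor from the opposite of Quiver_{<= g} to Z-modules.  Composition of
   minor morphisms is composition of the underlying maps, so the functor laws
   are stated for minor morphisms whose underlying map is an identity,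
   resp. a composite. *)
Record quiver_module (R : realType) (g : nat) := QuiverModule {
  mod_obj :> quiver_le R g -> zmodType;
  mod_map : forall Q' Q : quiver_le R g,
    minor R Q' Q -> {additive mod_obj Q -> mod_obj Q'};
  mod_map_id : forall (Q : quiver_le R g) (phi : minor R Q Q),
    phi =1 id -> mod_map phi =1 id;
  mod_map_comp : forall (Q'' Q' Q : quiver_le R g) (psi : minor R Q'' Q')
      (phi : minor R Q' Q) (chi : minor R Q'' Q),
    chi =1 phi \o psi -> mod_map chi =1 mod_map psi \o mod_map phi
}.

Record submodule (R : realType) (g : nat) (M : quiver_module R g) := Submodule {
  mem_sub : forall Q : quiver_le R g, M Q -> Prop;
  mem_sub0 : forall Q, mem_sub (0 : M Q);
  mem_subB : forall Q (x y : M Q), mem_sub x -> mem_sub y -> mem_sub (x - y);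
  mem_sub_map : forall (Q' Q : quiver_le R g) (phi : minor R Q' Q) (x : M Q),
    mem_sub x -> mem_sub (mod_map M phi x)
}.

(* Finite sets of quivers and of elements of the direct sum are given as finite
   families: classical_sets lives in too small a universe for them. *)
Record direct_sum (R : realType) (g : nat) (M : quiver_module R g) := DirectSum {
  dsum_coord :> forall Q : quiver_le R g, M Q;
  dsum_finite : exists (n : nat) (s : 'I_n -> quiver_le R g),
    forall Q, dsum_coord Q <> 0 -> exists j, Q = s j
}.

Definition contains_family (R : realType) (g : nat) (M : quiver_module R g)
    (N : submodule M) (n : nat) (S : 'I_n -> direct_sum M) : Prop :=
  forall (j : 'I_n) (Q : quiver_le R g), mem_sub N (S j Q).

Definition finitely_generated (R : realType) (g : nat)
    (M : quiver_module R g) : Prop :=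
  exists (n : nat) (S : 'I_n -> direct_sum M), forall N : submodule M,
    contains_family N S -> forall (Q : quiver_le R g) (x : M Q), mem_sub N x.

Lemma multipath_homology_id (R : realType) (i : nat) (Q : quiver)
    (phi : minor R Q Q) :
  phi =1 id -> homology_map (edge_lift_simplicial phi) (n := i) =1 id.
Proof.
move=> phi1; apply: homology_map_id => e.
by apply: edge_lift_unique; rewrite phi1.
Qed.

Lemma multipath_homology_comp (R : realType) (i : nat) (Q'' Q' Q : quiver)
    (psi : minor R Q'' Q') (phi : minor R Q' Q) (chi : minor R Q'' Q) :
  chi =1 phi \o psi ->
  homology_map (edge_lift_simplicial chi) (n := i) =1
    homology_map (edge_lift_simplicial psi) (n := i) \o
    homology_map (edge_lift_simplicial phi) (n := i).
Proof.
move=> chiE; apply: homology_map_comp => e.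
by apply: edge_lift_unique; rewrite chiE /= !edge_liftE.
Qed.

Definition multipath_homology (R : realType) (g i : nat) : quiver_module R g :=
  @QuiverModule R g (fun Q => homology (multipath_complex Q) i)
    (fun Q' Q phi => homology_map (edge_lift_simplicial phi) (n := i))
    (fun Q phi => @multipath_homology_id R i Q phi)
    (fun Q'' Q' Q psi phi chi =>
      @multipath_homology_comp R i Q'' Q' Q psi phi chi).

(* Main.v *)
(* Every connected quiver of genus at most g is a rooted spanning tree together
   with at most g + 1 further edges.  Once the children of each vertex are
   ordered, the further edges, an (i+1)-tuple of marked edges and the orientations
   are recorded by labels, from a fixed finite set, on a finite plane tree.  A
   Kruskal embedding of the labelled tree of Q into that of Q' contracts Q' onto
   Q: every vertex outside the image is merged into its parent.  This minor
   morphism preserves marked edges and is increasing for the preorder on edges,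
   hence for the lexicographic order on ordered simplices.  So leading terms of
   cycles are preserved by it, and since finite labelled trees are
   well-quasi-ordered (Kruskal), finitely many cycles suffice to reduce every
   cycle to zero by cancelling leading terms, as in the theory of Groebner bases. *)
From HB Require Import structures.
Require Import Defs.
From mathcomp Require Import all_boot all_order all_algebra.
From mathcomp Require Import all_classical all_reals.
From mathcomp Require Import generic_quotient topology normedtype zify.

Set Implicit Arguments.
Unset Strict Implicit.
Unset Printing Implicit Defensive.

Import Order.TTheory GRing.Theory Num.Theory.

(** * Well-quasi-orders and Kruskal's theorem *)

(** Only chains have leading terms, so a submodule of homology is replaced by its preimage among the
    cycles, and cycles are reduced instead of homology classes. Over the integers a leading
    coefficient cannot be normalized to 1. A code therefore consists of the labelled tree of a
    leading term and the absolute value of its coefficient: codes remain well-quasi-ordered, and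
    comparable codes allow a cancellation that makes the coefficient smaller. An embedding of trees
    controls tree edges only. The remaining edges are matched by their position in a list, and the
    labels of the vertices force their ends to correspond. Since directed trees are defined by
    contractibility of the realization, the fibres of a minor morphism call for an actual homotopy.
    Reading plane forests as binary trees turns Kruskal's theorem into the case of two ordered
    subtrees, where passing to subsequences twice takes the place of Higman's lemma on sequences. *)

Section Subsequences.
Variables (T : Type) (R : T -> T -> Prop).

Definition increasing (g : nat -> nat) := {homo g : i j / i < j}.

Definition good (f : nat -> T) := exists i j, i < j /\ R (f i) (f j).

Definition perfect (f : nat -> T) := forall i j, i < j -> R (f i) (f j).

Lemma increasing_step (g : nat -> nat) : (forall n, g n < g n.+1) -> increasing g.
Proof.
move=> gS i j; elim: j => // j IHj; rewrite ltnS leq_eqVlt => /predU1P[->//|/IHj ij].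
exact: ltn_trans (gS j).
Qed.

Lemma increasing_ge g n : increasing g -> n <= g n.
Proof. by move=> gi; elim: n => // n IHn; apply: leq_ltn_trans IHn (gi _ _ _). Qed.

(** The indices with no [R]-larger later term are bounded, for otherwise they would give a
    subsequence that is not good. Beyond the bound every term has a larger successor, and
    transitivity makes the chain of successors perfect. *)
Lemma perfect_subsequence (f : nat -> T) :
  (forall x y z, R x y -> R y z -> R x z) ->
  (forall g, increasing g -> good (f \o g)) ->
  exists2 g, increasing g & perfect (f \o g).
Proof.
move=> Rtr fg.
have [N NP] : exists N, forall i, N <= i -> exists j, i < j /\ R (f i) (f j).
  apply: contrapT => /forallNP noN.
  have /choice[t tP] n : exists i, n <= i /\ forall j, i < j -> ~ R (f i) (f j).
    apply: contrapT => /forallNP not; apply: (noN n) => i ni.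
    apply: contrapT => /forallNP noj; apply: (not i); split=> // j ij Rij.
    exact: (noj j).
  pose g n := iter n (fun m => t m.+1) (t 0).
  have gS n : g n < g n.+1 by have [] := tP (g n).+1.
  have gt n j : g n < j -> ~ R (f (g n)) (f j).
    by case: n => [|n]; apply: (tP _).2.
  have [i [j [ij Rij]]] := fg g (increasing_step gS).
  exact: gt (increasing_step gS ij) Rij.
have /choice[t tP] i : exists j, N <= i -> i < j /\ R (f i) (f j).
  by have [/NP[j jP]|] := leqP N i; [exists j|exists 0].
pose g n := iter n t N.
have gN n : N <= g n.
  elim: n => [|n IHn]; first exact: leqnn.
  apply: (leq_trans IHn (ltnW _)).
  by case: (tP _ IHn).
have gS n : g n < g n.+1 by case: (tP _ (gN n)).
exists g; first exact: increasing_step.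
move=> i; elim=> // j IHj; rewrite ltnS leq_eqVlt => /predU1P[->|/IHj Rij] /=.
  by case: (tP _ (gN j)).
by apply: Rtr Rij _; case: (tP _ (gN j)).
Qed.

End Subsequences.

Lemma good_leq (f : nat -> nat) : good leq f.
Proof.
apply: contrapT => /forallNP bad.
suff nolt n : forall i, f i < n -> False by exact: (nolt (f 0).+1 0).
elim: n => // n IHn i fin; apply: (IHn i.+1).
rewrite ltnS in fin; apply: leq_trans fin; rewrite ltnNge; apply/negP => le.
by apply: (bad i); exists i.+1.
Qed.

Lemma good_eq (L : finType) (f : nat -> L) : good eq f.
Proof.
apply: contrapT => /forallNP bad.
have inj : injective (fun i : 'I_#|L|.+1 => f i).
  move=> i j fij; apply: val_inj; case: (ltngtP i j) => // ij.
    by case: (bad i); exists j.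
  by case: (bad j); exists i.
by have := leq_card _ inj; rewrite card_ord ltnn.
Qed.

(** Nash-Williams' construction: each term has least measure among those that continue the prefix to
    some bad sequence. The limit is bad because goodness is witnessed inside a finite prefix. *)
Lemma minimal_bad_sequence (T : pointedType) (R : T -> T -> Prop) (m : T -> nat) f0 :
  ~ good R f0 -> exists2 f, ~ good R f &
    forall n g, ~ good R g -> (forall i, i < n -> g i = f i) -> m (f n) <= m (g n).
Proof.
move=> bad0.
pose pref s := exists2 g, ~ good R g & s = mkseq g (size s).
have /choice[next nextP] s : exists x, pref s ->
    pref (rcons s x) /\ forall y, pref (rcons s y) -> m x <= m y.
  have [ps|] := pselect (pref s); last by exists point.
  pose P n := `[< exists2 x, pref (rcons s x) & m x = n >].
  have exP : exists n, P n.
    case: ps => g bg sE; exists (m (g (size s))); apply/asboolP.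
    exists (g (size s)) => //; exists g => //.
    by rewrite size_rcons [in RHS]/mkseq -addn1 iotaD map_cat cats1 /= -/(mkseq g _) -sE.
  case: (ex_minnP exP) => n /asboolP[x px <-] minx; exists x => _; split=> // y py.
  by apply: minx; apply/asboolP; exists y.
pose S n := iter n (fun s => rcons s (next s)) [::].
pose f n := next (S n).
have SE n : S n = mkseq f n.
  by elim: n => // n IHn; rewrite /= {1}IHn /mkseq -[in RHS]addn1 iotaD map_cat cats1.
have Spref n : pref (S n).
  by elim: n => [|n /nextP[]//]; exists f0.
exists f => [[i [j [ij Rij]]]|n g bg gf].
  have [g bg] := Spref j.+1; rewrite SE size_mkseq => fgE; apply: bg.
  have fg k : k < j.+1 -> f k = g k.
    by move=> kj; have := congr1 (fun s => nth point s k) fgE; rewrite !nth_mkseq.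
  by exists i, j; rewrite -!fg // ltnW.
have [_] := nextP _ (Spref n); apply; exists g => //.
rewrite size_rcons SE size_mkseq [in RHS]/mkseq -addn1 iotaD map_cat cats1 /=.
by congr rcons; apply/eq_in_map => i; rewrite mem_iota => /gf.
Qed.

(* An ordered forest, as a binary tree: [Node x c s] is the forest whose first
   tree has root [x] above the forest [c], and whose other trees form [s]. *)
Inductive forest (A : Type) := Leaf | Node of A & forest A & forest A.
Arguments Leaf {A}.

Section Forests.
Variable A : Type.

Fixpoint nodes (D : forest A) : seq A :=
  if D is Node x c s then x :: nodes c ++ nodes s else [::].

Fixpoint forest_map B (f : A -> B) (D : forest A) : forest B :=
  if D is Node x c s then Node (f x) (forest_map f c) (forest_map f s) else Leaf.

End Forests.

(* [D] arises from a part of [D'] by contracting some vertices into their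
   parents, up to [rho] on labels. *)
Fixpoint embeds A B (rho : A -> B -> Prop) (D : forest A) (D' : forest B) : Prop :=
  if D' is Node y c' s' then
    if D is Node x c s then
      [\/ embeds rho D c', embeds rho D s' |
          [/\ rho x y, embeds rho c c' & embeds rho s s']]
    else True
  else if D is Leaf then True else False.

Lemma embeds_map A B C (f : A -> C) (g : B -> C) D D' :
  embeds eq (forest_map f D) (forest_map g D') ->
  embeds (fun x y => f x = g y) D D'.
Proof.
elim: D' D => [|y c' IHc s' IHs] [|x c s] //= [|| [xy cc ss]].
- by move=> /(IHc (Node x c s)); apply: Or31.
- by move=> /(IHs (Node x c s)); apply: Or32.
- by apply: Or33; split; [|exact: IHc|exact: IHs].
Qed.

Section Kruskal.
Variable L : finType.
Implicit Types D : forest L.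

Lemma embeds_trans D1 D2 D3 : embeds eq D1 D2 -> embeds eq D2 D3 -> embeds eq D1 D3.
Proof.
elim: D3 D1 D2 => [|z c3 IHc s3 IHs] [|x c1 s1] // [|y c2 s2] //= D12.
case=> [D2c|D2s|[<- D2c D2s]].
- by apply: Or31; apply: IHc D2c.
- by apply: Or32; apply: IHs D2s.
case: D12 => [D1c|D1s|[-> D1c D1s]].
- by apply: Or31; apply: IHc D2c.
- by apply: Or32; apply: IHs D2s.
- by apply: Or33; split=> //; [apply: IHc D2c|apply: IHs D2s].
Qed.

HB.instance Definition _ := gen_eqMixin (forest L).
HB.instance Definition _ := gen_choiceMixin (forest L).
HB.instance Definition _ := isPointed.Build (forest L) Leaf.

Let weight D := size (nodes D).

(** If [p \o g] were bad, then [f] cut at position [g 0] and continued by [p \o g] would be bad as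
    well, since what embeds into [p n] embeds into [f n]. But that sequence is smaller than the
    minimal [f] at position [g 0]. *)
Lemma good_part (f p : nat -> forest L) :
  ~ good (embeds eq) f ->
  (forall n g, ~ good (embeds eq) g -> (forall i, i < n -> g i = f i) ->
    weight (f n) <= weight (g n)) ->
  (forall n, weight (p n) < weight (f n)) ->
  (forall D n, embeds eq D (p n) -> embeds eq D (f n)) ->
  forall g, increasing g -> good (embeds eq) (p \o g).
Proof.
move=> bf minf wp pf g gi; apply: contrapT => bpg.
pose h k := if k < g 0 then f k else p (g (k - g 0)).
have : weight (f (g 0)) <= weight (h (g 0)).
  apply: minf => [|i ig]; last by rewrite /h ig.
  case=> i [j [ij]]; rewrite /h; case: ltnP => ig; case: ltnP => jg Rij.
  - by apply: bf; exists i, j.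
  - apply: bf; exists i, (g (j - g 0)); split; last exact: pf Rij.
    apply: leq_trans ig _; case: (j - g 0) => // k; exact/ltnW/gi.
  - by have := leq_trans jg (leq_trans ig (ltnW ij)); rewrite ltnn.
  - apply: bpg; exists (i - g 0), (j - g 0); split=> //.
    by rewrite ltn_sub2r // (leq_ltn_trans ig ij).
by rewrite /h ltnn subnn leqNgt wp.
Qed.

(** Along a minimal bad sequence, every subsequence of either kind of binary subtree is good by
    [good_part]. Two passages to subsequences make both subtrees embed at once, and among finitely
    many labels one repeats. *)
Lemma kruskal (f : nat -> forest L) : good (embeds eq) f.
Proof.
apply: contrapT => /(@minimal_bad_sequence _ _ weight)[{}f bf minf].
have /choice[d dP] n : exists d : L * forest L * forest L, f n = Node d.1.1 d.1.2 d.2.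
  case fn: (f n) => [|x c s]; last by exists (x, c, s).
  case: bf; exists n, n.+1; split=> //; rewrite fn; by case: (f _).
have [g1 g1i g1P] : exists2 g, increasing g &
    perfect (embeds eq) ((fun n => (d n).1.2) \o g).
  apply: perfect_subsequence; first exact: embeds_trans.
  apply: (good_part bf minf) => [n|D n Dn]; rewrite dP /weight /=.
    by rewrite ltnS size_cat leq_addr.
  by case: D Dn => // x c s Dn; apply: Or31.
have [g2 g2i g2P] : exists2 g, increasing g &
    perfect (embeds eq) ((fun n => (d n).2) \o g1 \o g).
  apply: perfect_subsequence; first exact: embeds_trans.
  move=> g gi; apply: (good_part bf minf (p := fun n => (d n).2) _ _ (g := g1 \o g))
    => [n|D n Dn|i j ij].
  - by rewrite dP /weight /= ltnS size_cat leq_addl.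
  - by rewrite dP /=; case: D Dn => // x c s Dn; apply: Or32.
  - exact/g1i/gi.
have [i [j [ij lij]]] := good_eq (fun n => (d (g1 (g2 n))).1.1).
apply: bf; exists (g1 (g2 i)), (g1 (g2 j)); split; first exact/g1i/g2i.
rewrite !dP /=; apply: Or33; split=> //; last exact: g2P.
exact/g1P/g2i.
Qed.

Variable K : finType.

(** Label of the root, labelled forest, absolute value of a leading coefficient. *)
Definition forest_code := (K * forest L * nat)%type.

Definition code_le (a b : forest_code) : Prop :=
  [/\ a.1.1 = b.1.1, embeds eq a.1.2 b.1.2 & a.2 <= b.2].

Lemma good_code (f : nat -> forest_code) : good code_le f.
Proof.
have [g1 g1i g1P] : exists2 g, increasing g & perfect leq ((fun n => (f n).2) \o g).
  apply: perfect_subsequence => [x y z|g _]; [exact: leq_trans|exact: good_leq].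
have [g2 g2i g2P] : exists2 g, increasing g &
    perfect (embeds eq) ((fun n => (f n).1.2) \o g1 \o g).
  apply: perfect_subsequence => [|g _]; [exact: embeds_trans|exact: kruskal].
have [i [j [ij lij]]] := good_eq (fun n => (f (g1 (g2 n))).1.1).
exists (g1 (g2 i)), (g1 (g2 j)); split; first exact/g1i/g2i.
by split=> //; [exact: g2P|exact/g1P/g2i].
Qed.

(** Were there no such finite family, a list of elements of [S] could be prolonged forever by
    elements above none of the earlier ones, which gives a sequence that is not good. *)
Lemma code_basis (S : forest_code -> Prop) :
  exists n (w : 'I_n -> forest_code), (forall j, S (w j)) /\
    forall a, S a -> exists j, code_le (w j) a.
Proof.
have [[a0 Sa0]|noS] := pselect (exists a, S a); last first.
  have no : 'I_0 -> forest_code by case.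
  by exists 0, no; split=> [[]//|a Sa]; case: noS; exists a.
apply: contrapT => nob.
have /choice[t tP] (s : seq forest_code) : exists a,
    (forall w, w \in s -> S w) -> S a /\ forall w, w \in s -> ~ code_le w a.
  have [sS|] := pselect (forall w, w \in s -> S w); last by exists a0.
  apply: contrapT => /forallNP noa; apply: nob.
  exists (size s), (tnth (in_tuple s)); split=> [j|a Sa].
    by apply: sS; exact: mem_tnth.
  apply: contrapT => /forallNP noj; apply: (noa a) => _; split=> // w /seq_tnthP[j ->].
  exact: noj.
pose s n := iter n (fun s => rcons s (t s)) [::].
have sS n w : w \in s n -> S w.
  elim: n w => // n IHn w; rewrite mem_rcons inE => /predU1P[->|]; last exact: IHn.
  by have [] := tP _ IHn.
have ts i j : i < j -> t (s i) \in s j.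
  elim: j => // j IHj; rewrite ltnS leq_eqVlt mem_rcons inE => /predU1P[->|/IHj ->].
    by rewrite eqxx.
  by rewrite orbT.
have [i [j [ij le]]] := good_code (t \o s).
by have [_ /(_ _ (ts _ _ ij))] := tP _ (sS j).
Qed.

End Kruskal.

(** * Geometric realizations *)

Definition joins (Q : quiver) (e : edge Q) (p v : vert Q) : bool :=
  (src e == p) && (tgt e == v) || (src e == v) && (tgt e == p).

Section Topology.
Import numFieldTopology.Exports numFieldNormedType.Exports.
Local Open Scope ring_scope.
Local Open Scope quotient_scope.
Local Open Scope classical_set_scope.

Lemma continuous_addl (R : realType) (T : topologicalType) (a : R) (f : T -> R) :
  continuous f -> continuous (fun x => a + f x).
Proof. by move=> cf x; apply: cvgD; [exact: cvg_cst|exact: cf]. Qed.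

Lemma continuous_subl (R : realType) (T : topologicalType) (a : R) (f : T -> R) :
  continuous f -> continuous (fun x => a - f x).
Proof. by move=> cf x; apply: cvgB; [exact: cvg_cst|exact: cf]. Qed.

Lemma continuous_mulr (R : realType) (T : topologicalType) (a : R) (f : T -> R) :
  continuous f -> continuous (fun x => f x * a).
Proof. by move=> cf x; apply: cvgM; [exact: cf|exact: cvg_cst]. Qed.

Lemma continuous_minr (R : realType) (T : topologicalType) (f g : T -> R) :
  continuous f -> continuous g -> continuous (fun x => Num.min (f x) (g x)).
Proof. by move=> cf cg x; exact: (continuous_min (cf x) (cg x)). Qed.

Lemma continuous_pair (T U V : topologicalType) (f : T -> U) (g : T -> V) :
  continuous f -> continuous g -> continuous (fun x => (f x, g x)).
Proof. by move=> cf cg x; apply: cvg_pair; [exact: cf|exact: cg]. Qed.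

Section RealizationTheory.
Variables (R : realType) (Q : quiver).

Definition glue (x : {c & @cell R Q c}) : realization R Q :=
  \pi_(quotient_topology {eq_quot (glued_equiv R Q)}) x.

Lemma glueP x y : attach x = attach y -> glue x = glue y.
Proof. by move=> xy; apply/eqmodP; rewrite /= /glued xy eqxx. Qed.

Lemma attach_repr x : attach (repr (glue x)) = attach x.
Proof.
by rewrite /glue; case: piP => y /eqmodP; rewrite /= /glued eq_sym => /eqP.
Qed.

Definition vert_pt (v : vert Q) : realization R Q :=
  glue (existT (@cell R Q) (inl v) tt).

Definition edge_pt (e : edge Q) (s : unit_interval R) : realization R Q :=
  glue (existT (@cell R Q) (inr e) s).

Lemma itv01 : itv1 R != itv0 R.
Proof. by apply/eqP => /(congr1 val)/eqP; rewrite /= oner_eq0. Qed.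

Lemma edge_pt0 e : edge_pt e (itv0 R) = vert_pt (src e).
Proof. by apply: glueP; rewrite /= eqxx. Qed.

Lemma edge_pt1 e : edge_pt e (itv1 R) = vert_pt (tgt e).
Proof. by apply: glueP; rewrite /= eqxx (negbTE itv01). Qed.

Lemma edge_pt_continuous e : continuous (edge_pt e).
Proof.
move=> s; apply: (@continuous_comp _ _ _ (existT (@cell R Q) (inr e))).
  exact: existT_continuous.
exact: pi_continuous.
Qed.

(** The 0-cells in [A] and the 1-cells starting in [A] form a clopen part: [f] is constant on each
    cell and respects the gluing. *)
Lemma connected_closed_verts (A : {set vert Q}) :
  quiver_connected R Q -> A != finset.set0 ->
  (forall e : edge Q, (src e \in A) = (tgt e \in A)) -> A = [set: vert Q]%SET.
Proof.
move=> Qc A0 Ae.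
pose f (p : {c & @cell R Q c}) :=
  match projT1 p with inl v => v \in A | inr e => src e \in A end.
have fE p q : attach p = attach q -> f p = f q.
  pose a (x : vert Q + {c & @cell R Q c}) :=
    match x with inl v => v \in A | inr p => f p end.
  suff faE r : f r = a (attach r) by rewrite !faE => ->.
  by case: r => [[v|e] x] //=; case: eqP => // _; case: eqP => // _; exact: Ae.
have frE p : f (repr (glue p)) = f p by apply: fE; rewrite attach_repr.
have oB (b : bool) : open [set x : realization R Q | f (repr x) = b].
  rewrite /open /= /quotient_open; apply/sigT_openP => c.
  pose C := match c with inl v => v \in A | inr e => src e \in A end.
  rewrite [X in open X](_ : _ = if C == b then setT else set0).
    by case: ifP => _; [exact: openT|exact: open0].
  apply/seteqP; split=> x /=; rewrite -/(glue _) frE /f /= -/C.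
    by move=> ->; rewrite eqxx.
  by case: eqP.
have [v vA] := set0Pn _ A0.
have BT : [set x : realization R Q | f (repr x) = true] = setT.
  apply: Qc.
  - by exists (vert_pt v); rewrite /= frE.
  - by exists [set x | f (repr x) = true]; [exact: oB|rewrite setTI].
  - exists [set x | f (repr x) = true]; last by rewrite setTI.
    rewrite -openC (_ : ~` _ = [set x | f (repr x) = false]); first exact: oB.
    by apply/seteqP; split=> x /=; case: (f _).
apply/setP => w; rewrite inE.
have : [set x : realization R Q | f (repr x) = true] (vert_pt w) by rewrite BT.
by rewrite /= frE.
Qed.

(** Retracting the line onto the unit interval turns 1-cells into paths defined on all of [R], which
    can be shifted and pasted freely. *)
Definition clamp (s : R) : R := Num.max 0 (Num.min 1 s).

Lemma clamp_subproof s : clamp s \in `[0%R, 1%R]%classic.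
Proof.
by rewrite inE /= in_itv /= /clamp le_max lexx ge_max ler01 ge_min lexx.
Qed.

Definition to_itv (s : R) : unit_interval R :=
  exist (fun x : R => x \in `[0%R, 1%R]%classic) _ (clamp_subproof s).

Lemma to_itv_continuous : continuous to_itv.
Proof.
move=> s; apply: (continuous_comp_initial (w := set_val)) => {}s.
rewrite [X in continuous_at _ X](_ : _ = clamp) //.
apply: continuous_max; first exact: cvg_cst.
by apply: continuous_min; [exact: cvg_cst|exact: cvg_id].
Qed.

Lemma to_itv_val (s : unit_interval R) : to_itv (val s) = s.
Proof.
case: s => s sI; apply: val_inj => /=.
move: sI; rewrite inE /= in_itv /= => /andP[s0 s1].
by rewrite /clamp (min_idPr s1) (max_idPr s0).
Qed.

Lemma to_itv0 : to_itv 0 = itv0 R.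
Proof. by apply: val_inj; rewrite /= /clamp (min_idPr ler01) maxxx. Qed.

Lemma to_itv1 : to_itv 1 = itv1 R.
Proof. by apply: val_inj; rewrite /= /clamp minxx (max_idPr ler01). Qed.

Lemma paste_continuous (T : topologicalType) (f g : R -> T) a :
  continuous f -> continuous g -> f a = g a ->
  continuous (fun y => if y <= a then f y else g y).
Proof.
move=> cf cg fga.
pose h y := if y <= a then f y else g y.
have clf : {within [set y : R | y <= a], continuous h}.
  apply: (@subspace_eq_continuous _ _ _ f); last exact: continuous_subspaceT.
  by move=> y /set_mem /= ya; rewrite /from_subspace /h ya.
have clg : {within [set y : R | a <= y], continuous h}.
  apply: (@subspace_eq_continuous _ _ _ g); last exact: continuous_subspaceT.
  move=> y /set_mem /= ay; rewrite /from_subspace /h; case: ifP => // ya.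
  by rewrite (_ : y = a) //; apply/eqP; rewrite eq_le ya.
have := withinU_continuous (@closed_le R a) (@closed_ge R a) clf clg.
rewrite (_ : _ `|` _ = setT); first
  by move=> ch; apply/continuous_subspace_setT; exact: ch.
by apply/seteqP; split=> // y _ /=; exact/orP/le_total.
Qed.

End RealizationTheory.

(** * Contractibility of rooted trees *)

Section RootedTree.
Variables (R : realType) (P : quiver) (r : vert P) (depth : vert P -> nat).
Variable up : vert P -> edge P -> Prop.
Hypothesis up_ex : forall v, v != r -> exists e, up v e.
Hypothesis up_onto : forall e, exists2 v, v != r & up v e.
Hypothesis up_joins : forall v e, up v e ->
  exists2 q, joins e q v & depth v = (depth q).+1.
Hypothesis up_fun : forall v e e', up v e -> up v e' -> e = e'.

Let X := realization R P.
Let pt : vert P -> X := @vert_pt R P.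

(** The path [qs.2] always runs from the parent to [v], whereas the edge may point either way; [b]
    is true when it points away from the root. *)
Lemma segment_to_parent v : exists qs : vert P * (R -> X), v != r ->
  [/\ depth v = (depth qs.1).+1, continuous qs.2, qs.2 0 = pt qs.1, qs.2 1 = pt v &
   forall e, up v e -> exists b : bool,
     [/\ (if b then tgt e else src e) = v, (if b then src e else tgt e) = qs.1 &
      forall s, edge_pt e s = qs.2 (if b then val s else 1 - val s)]].
Proof.
have [->|vr] := eqVneq v r; first by exists (r, fun=> pt r).
have [e ve] := up_ex vr; have [q eqv dv] := up_joins ve.
case/orP: (eqv) => /andP[/eqP es /eqP et].
  exists (q, @edge_pt R P e \o @to_itv R); split=> //=.
  - move=> s; apply: continuous_comp; first exact: to_itv_continuous.
    exact: edge_pt_continuous.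
  - by rewrite to_itv0 edge_pt0 es.
  - by rewrite to_itv1 edge_pt1 et.
  - move=> e' /(up_fun ve) <-; exists true; split=> // s.
    by rewrite to_itv_val.
exists (q, @edge_pt R P e \o @to_itv R \o (fun s => 1 - s)); split=> //=.
- move=> s; apply: continuous_comp.
    by apply: continuousB; [exact: cvg_cst|exact: cvg_id].
  apply: continuous_comp; first exact: to_itv_continuous.
  exact: edge_pt_continuous.
- by rewrite subr0 to_itv1 edge_pt1 et.
- by rewrite subrr to_itv0 edge_pt0 es.
- move=> e' /(up_fun ve) <-; exists false; split=> // s.
  by rewrite subKr to_itv_val.
Qed.

Let qs := projT1 (choice segment_to_parent).
Let par v := (qs v).1.
Let seg v := (qs v).2.
Let qsP v : v != r -> [/\ depth v = (depth (par v)).+1, continuous (seg v),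
  seg v 0 = pt (par v), seg v 1 = pt v & forall e, up v e -> exists b : bool,
     [/\ (if b then tgt e else src e) = v, (if b then src e else tgt e) = par v &
      forall s, edge_pt e s = seg v (if b then val s else 1 - val s)]].
Proof. exact: projT2 (choice segment_to_parent) v. Qed.

Let par_neq v : v != r -> par v != v.
Proof.
by move=> /qsP[dv _ _ _ _]; apply/eqP => E; rewrite E in dv; case: (n_Sn _ dv).
Qed.

(* For [n] the depth of [v], the point at height [y] on the path that climbs from
   the root to [v], edges having length 1. *)
Fixpoint descent n v (y : R) : X :=
  if n is m.+1 then
    if v == r then pt v else
    if y <= m%:R then descent m (par v) y else seg v (y - m%:R)
  else pt v.

Lemma descent_top v : descent (depth v) v (depth v)%:R = pt v.
Proof.
case dv: (depth v) => [|m] //=; case: eqP => // /eqP vr.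
rewrite ler_nat ltnn -natr1 addrAC subrr add0r.
by have [] := qsP vr.
Qed.

Lemma descent_par v y : v != r -> y <= (depth (par v))%:R ->
  descent (depth v) v y = descent (depth (par v)) (par v) y.
Proof. by move=> vr yle; have [-> _ _ _ _] := qsP vr; rewrite /= (negbTE vr) yle. Qed.

Lemma descent_seg v y : v != r -> (depth (par v))%:R <= y ->
  descent (depth v) v y = seg v (y - (depth (par v))%:R).
Proof.
move=> vr yle; have [-> _ s0 _ _] := qsP vr; rewrite /= (negbTE vr).
case: ifP => // yge; have -> : y = (depth (par v))%:R by apply/eqP; rewrite eq_le yge.
by rewrite subrr s0 descent_top.
Qed.

Lemma descent_continuous v : continuous (descent (depth v) v).
Proof.
move dv: (depth v) => n; elim: n v dv => [|n IHn] v dv; first by move=> y; exact: cvg_cst.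
have [->|vr] := eqVneq v r.
  rewrite (_ : descent _ _ = fun=> pt r) => [y|]; first exact: cvg_cst.
  by apply/funext => y /=; rewrite eqxx.
have [dp sc s0 _ _] := qsP vr.
rewrite (_ : descent _ _ = fun y =>
    if y <= n%:R then descent n (par v) y else seg v (y - n%:R)); last first.
  by apply/funext => y /=; rewrite (negbTE vr).
have dp' : depth (par v) = n by move: dp; rewrite dv => -[].
apply: paste_continuous; first exact: IHn.
  move=> y; apply: (@continuous_comp R R X (fun y : R => y - n%:R) (seg v) y);
    last exact: sc.
  by apply: continuousB; [exact: cvg_id|exact: cvg_cst].
by rewrite -dp' descent_top subrr s0.
Qed.

Lemma descent_bottom v y : y <= 0 -> descent (depth v) v y = pt r.
Proof.
move=> y0; move dv: (depth v) => n; elim: n v dv => [|n IHn] v dv /=.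
  by have [->//|/qsP[]] := eqVneq v r; rewrite dv.
have [->//|/qsP[]] := eqVneq v r; rewrite dv => -[dp] _ _ _ _.
by rewrite (le_trans y0 (ler0n _ _)) IHn.
Qed.

Let low e := sval (cid2 (up_onto e)).
Let lowP e : low e != r /\ up (low e) e.
Proof. by rewrite /low; case: cid2. Qed.

(** Since [low e] is the end of [e] farther from the root, the height is the depth of the other end
    plus the distance travelled from there. *)
Let height e (s : unit_interval R) : R :=
  (depth (par (low e)))%:R + (if tgt e == low e then val s else 1 - val s).

Let height_continuous e : continuous (height e).
Proof.
have cval : continuous (val : unit_interval R -> R) by exact: initial_continuous.
apply: (@continuous_addl R (unit_interval R)).
case: (tgt e == low e); first exact: cval.
exact: (@continuous_subl R (unit_interval R)).
Qed.

(* [truncate p t] lowers the point [p] to height at most [t]; letting [t] decrease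
   to 0 contracts the tree to its root. *)
Definition truncate (p : {c & @cell R P c}) (t : R) : X :=
  match p with
  | existT (inl v) _ => descent (depth v) v (Num.min (depth v)%:R t)
  | existT (inr e) s => descent (depth (low e)) (low e) (Num.min (height e s) t)
  end.

Lemma truncate_attach p q : attach p = attach q -> truncate p = truncate q.
Proof.
pose a (x : vert P + {c & @cell R P c}) := match x with
  | inl v => truncate (existT (@cell R P) (inl v) tt) | inr p => truncate p end.
suff aE x : truncate x = a (attach x) by rewrite !aE => ->.
case: x => [[v|e] s] //=; have [lr le] := lowP e.
have [dp _ _ _ /(_ e le)[b [b1 b2 _]]] := qsP lr.
have topE h : h = (depth (low e))%:R :> R -> forall t,
    descent (depth (low e)) (low e) (Num.min h t) =
    descent (depth (low e)) (low e) (Num.min (depth (low e))%:R t) by move=> ->.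
have parE h : h = (depth (par (low e)))%:R :> R -> forall t,
    descent (depth (low e)) (low e) (Num.min h t) =
    descent (depth (par (low e))) (par (low e)) (Num.min (depth (par (low e)))%:R t).
  by move=> -> t; rewrite descent_par // ge_min lexx.
have pl := par_neq lr.
have [->|s0] := eqVneq s (itv0 R).
  apply/funext => t; case: b b1 b2 => b1 b2.
    by rewrite b2; apply: parE; rewrite /height b1 eqxx addr0.
  rewrite b1; apply: topE; rewrite /height b2 (negbTE pl) subr0.
  by rewrite dp natr1.
have [->|s1] := eqVneq s (itv1 R) => //.
apply/funext => t; case: b b1 b2 => b1 b2.
  by rewrite b1; apply: topE; rewrite /height b1 eqxx dp natr1.
by rewrite b2; apply: parE; rewrite /height b2 (negbTE pl) subrr addr0.
Qed.

Lemma truncate_ge p t : (forall v, (depth v)%:R <= t) -> truncate p t = glue p.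
Proof.
move=> dt; case: p => [[v|e] s] /=.
  by rewrite (min_idPl (dt v)) descent_top; apply: glueP.
have [lr le] := lowP e; have [dp _ s0 _ /(_ e le)[b [b1 b2 bE]]] := qsP lr.
have pl := par_neq lr.
have sI : 0 <= (val s : R) <= 1 by case: (s) => x /=; rewrite inE /= in_itv.
have [sI0 sI1] := andP sI.
have hE : height e s = (depth (par (low e)))%:R + (if b then val s else 1 - val s).
  rewrite /height; case: b b1 b2 {bE} => b1 b2; first by rewrite b1 eqxx.
  by rewrite b2 (negbTE pl).
have bI : 0 <= (if b then val s else 1 - val s : R) <= 1.
  by case: b {bE b1 b2 hE}; rewrite // subr_ge0 sI1 lerBlDr lerDl.
have [bI0 bI1] := andP bI.
rewrite (min_idPl _); last first.
  by rewrite hE (le_trans _ (dt (low e))) // dp -natr1 lerD2l.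
rewrite descent_seg //; last by rewrite hE lerDl.
by rewrite hE addrAC subrr add0r -bE.
Qed.

Lemma truncate_le0 p t : t <= 0 -> truncate p t = pt r.
Proof.
by move=> t0; case: p => [[v|e] s] /=; rewrite descent_bottom // ge_min t0 orbT.
Qed.

(** The difficulty is that the product of a quotient map with [R] has to behave like a quotient map.
    Curried into the compact-open function space, the homotopy can be checked cell by cell and
    descends to the quotient; local compactness of [R] permits uncurrying. *)
Lemma truncate_continuous :
  continuous (uncurry (fun (x : X) (t : R) => truncate (repr x) t)).
Proof.
have cmin v (a : R) : continuous (fun t => descent (depth v) v (Num.min a t)).
  move=> t; apply: (@continuous_comp _ _ _ (fun t => Num.min a t)).
    by apply: (@continuous_minr R R (fun=> a) id) => {}t; [exact: cvg_cst|exact: cvg_id].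
  exact: descent_continuous.
have ct p : continuous (truncate p).
  by case: p => [[v|e] s]; exact: cmin.
have ce e : continuous ((fun s => truncate (existT _ (inr e) s)) :
    unit_interval R -> {compact-open, R -> X}).
  apply: (@continuous_curry_fun (unit_interval R) R X (fun st =>
     descent (depth (low e)) (low e) (Num.min (height e st.1) st.2))) => st.
  apply: (@continuous_comp _ _ _
    (fun st : unit_interval R * R => Num.min (height e st.1) st.2));
    last exact: descent_continuous.
  apply: (@continuous_minr R (unit_interval R * R)%type
    (fun st => height e st.1) snd) => {}st.
    apply: (@continuous_comp _ _ _ fst (height e)); first exact: cvg_fst.
    exact: height_continuous.
  exact: cvg_snd.
have cv v : continuous ((fun s => truncate (existT _ (inl v) s)) :
    discrete_topology unit -> {compact-open, R -> X}).
  exact: (@cst_continuous (discrete_topology unit) {compact-open, R -> X}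
    (fun t => descent (depth v) v (Num.min (depth v)%:R t))).
apply: continuous_uncurry.
- exact: locally_compactR.
- exact: Rhausdorff.
- apply: (@repr_comp_continuous _ _ {compact-open, R -> X} truncate).
    by move=> [[v|e] s]; [exact: cv|exact: ce].
  move=> p q /eqP /eqmodP /= /eqP pq; apply/eqP; exact: truncate_attach.
- by move=> x; exact: ct.
Qed.

Lemma rooted_directed_tree : directed_tree R P.
Proof.
(* Cutting at the maximal depth removes nothing, so the homotopy starts at the identity. *)
pose N : R := (\max_v depth v)%:R.
pose H := uncurry (fun (x : X) (t : R) => truncate (repr x) t).
exists (pt r), (fun xt => H (xt.1, (1 - val xt.2) * N)); split.
- move=> xt; apply: (@continuous_comp _ _ _
    (fun xt : X * unit_interval R => (xt.1, (1 - val xt.2) * N))).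
    apply: (@continuous_pair (X * unit_interval R)%type X R fst).
      by move=> ?; exact: cvg_fst.
    apply: (@continuous_mulr R (X * unit_interval R)%type).
    apply: (@continuous_subl R (X * unit_interval R)%type) => {}xt.
    apply: (@continuous_comp (X * unit_interval R)%type (unit_interval R) R snd val).
      exact: cvg_snd.
    exact: initial_continuous.
  exact: truncate_continuous.
- move=> x; rewrite /H /= subr0 mul1r truncate_ge; last first.
    by move=> v; rewrite ler_nat leq_bigmax.
  exact: reprK.
- by move=> x; rewrite /H /= subrr mul0r truncate_le0.
Qed.

End RootedTree.

End Topology.

(** * Spanning forests and contractions *)

Section QuiverForests.
Variable Q : quiver.
Implicit Types (p v : vert Q) (e : edge Q) (D : forest (vert Q * edge Q)).

Definition verts D := map fst (nodes D).
Definition edges D := map snd (nodes D).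

(* Every node [(v, e)] of [D] is a vertex [v] joined by [e] to its parent, which
   is [p] for the roots of [D]. *)
Fixpoint rooted p D : bool :=
  if D is Node x c s then [&& joins x.2 p x.1, rooted x.1 c & rooted p s] else true.

Lemma verts_node x c s : verts (Node x c s) = x.1 :: verts c ++ verts s.
Proof. by rewrite /verts /= map_cat. Qed.

Lemma edges_node x c s : edges (Node x c s) = x.2 :: edges c ++ edges s.
Proof. by rewrite /edges /= map_cat. Qed.

Lemma mem_verts D v e : (v, e) \in nodes D -> v \in verts D.
Proof. by move=> vD; apply/mapP; exists (v, e). Qed.

Lemma mem_edges D v e : (v, e) \in nodes D -> e \in edges D.
Proof. by move=> vD; apply/mapP; exists (v, e). Qed.

Lemma joins_ends e p v : joins e p v ->
  (src e \in [:: p; v]) && (tgt e \in [:: p; v]).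
Proof. by rewrite !inE => /orP[] /andP[-> ->]; rewrite ?orbT. Qed.

Lemma rooted_joins p D v e : rooted p D -> (v, e) \in nodes D ->
  exists2 q, q \in p :: verts D & joins e q v.
Proof.
elim: D p => // x c IHc s IHs p /= /and3P[xp rc rs].
rewrite inE mem_cat verts_node => /or3P[/eqP xE|/(IHc _ rc)|/(IHs _ rs)].
- by exists p; [exact: mem_head|rewrite -xE in xp].
- by move=> [q qc ?]; exists q => //; rewrite inE -cat_cons mem_cat qc orbT.
- move=> [q qs ?]; exists q => //; move: qs; rewrite !inE mem_cat.
  by case/predU1P => [->|->]; rewrite ?eqxx ?orbT.
Qed.

Lemma rooted_ends p D v e : rooted p D -> (v, e) \in nodes D ->
  (src e \in p :: verts D) && (tgt e \in p :: verts D).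
Proof.
move=> rD vD; have [q qD /joins_ends] := rooted_joins rD vD.
have vD' : v \in p :: verts D by rewrite inE (mem_verts vD) orbT.
by rewrite !inE => /andP[] /orP[] /eqP-> /orP[] /eqP->; rewrite -!in_cons ?qD ?vD'.
Qed.

(** The starting depth [d] varies for the induction, since the children of a node begin one level
    deeper. Disjointness of the two subforests lets their depth functions be combined. *)
Lemma rooted_depth p D d : rooted p D -> uniq (p :: verts D) ->
  exists2 depth : vert Q -> nat, depth p = d &
  forall v e, (v, e) \in nodes D -> exists q, [/\ q \in p :: verts D,
    joins e q v & depth v = (depth q).+1].
Proof.
elim: D p d => [|[w f] c IHc s IHs] p d; first by exists (fun=> d).
move=> /and3P[xp rc rs]; rewrite verts_node !cons_uniq cat_uniq inE !mem_cat !negb_or.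
move=> /and3P[/and3P[px pc ps] /andP[xc xs] /and3P[uc cs us]].
have [|d1 d1x d1P] := IHc w d.+1 rc; first by rewrite /= xc.
have [|d2 d2p d2P] := IHs p d rs; first by rewrite /= ps.
have pxc : p \notin w :: verts c by rewrite inE negb_or px.
have disj u : u \in p :: verts s -> u \notin w :: verts c.
  rewrite inE => /predU1P[->//|us']; rewrite inE negb_or; apply/andP; split.
    by apply: contraNneq xs => <-.
  by move/hasPn: cs; apply.
exists (fun u => if u \in w :: verts c then d1 u else d2 u).
  by rewrite (negbTE pxc) d2p.
move=> v e; rewrite inE mem_cat => /or3P[/eqP[-> ->]|vc|vs].
- by exists p; rewrite mem_head (negbTE pxc) d2p mem_head d1x.
- have [q [qc eq dv]] := d1P _ _ vc; exists q; split=> //.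
    by rewrite inE -cat_cons mem_cat qc orbT.
  by rewrite qc inE (mem_verts vc) orbT.
- have [q [qs eq dv]] := d2P _ _ vs; exists q; split=> //.
    by move: qs; rewrite !inE mem_cat => /predU1P[->|->]; rewrite ?eqxx ?orbT.
  by rewrite (negbTE (disj q qs)) (negbTE (disj v _)) // inE (mem_verts vs) orbT.
Qed.

Lemma rooted_grow p D u e w : rooted p D -> u \in p :: verts D -> joins e u w ->
  exists2 D2, rooted p D2 & perm_eq (nodes D2) ((w, e) :: nodes D).
Proof.
move=> rD uD euw; elim: D p rD uD => [|x c IHc s IHs] p.
  move=> _; rewrite inE => /eqP up.
  by exists (Node (w, e) Leaf Leaf); rewrite /= -?up ?euw.
move=> rD; have /and3P[xp rc rs] := rD.
rewrite inE => /predU1P[up|].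
  by subst u; exists (Node (w, e) Leaf (Node x c s)) => //; apply/and3P.
rewrite verts_node -cat_cons mem_cat => /orP[uc|us].
  have [D2 rD2 pD2] := IHc _ rc uc; exists (Node x D2 s); first by apply/and3P.
  apply: (@perm_trans _ (x :: ((w, e) :: nodes c) ++ nodes s)).
    by rewrite /= perm_cons -cat_cons perm_cat2r.
  by rewrite -cat1s -[in X in perm_eq _ X]cat1s /= (perm_catCA [:: x] [:: (w, e)]).
have [|D2 rD2 pD2] := IHs _ rs; first by rewrite inE us orbT.
exists (Node x c D2); first by apply/and3P.
have C : perm_eq ((x :: nodes c) ++ [:: (w, e)] ++ nodes s)
    ((w, e) :: nodes (Node x c s)).
  by rewrite perm_catCA.
apply: perm_trans C.
by rewrite -[nodes (Node _ _ _)]/((x :: nodes c) ++ nodes D2) perm_cat2l.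
Qed.

(** Take a forest with the most nodes. An edge leaving its vertex set would allow one more node, and
    such an edge is new because the edges in use have both ends in the forest. So the vertex set is
    closed under edges. *)
Lemma spanning_forest p :
  (forall A : {set vert Q}, A != finset.set0 ->
    (forall e, (src e \in A) = (tgt e \in A)) -> A = [set: vert Q]) ->
  exists D, [/\ rooted p D, uniq (p :: verts D), (forall v, v \in p :: verts D) &
    uniq (edges D)].
Proof.
move=> conn.
pose P n := `[< exists D, [/\ rooted p D, uniq (p :: verts D), uniq (edges D) &
  size (nodes D) = n] >].
have exP : exists n, P n by exists 0; apply/asboolP; exists Leaf.
have ubP n : P n -> n <= #|vert Q|.
  move=> /asboolP[D [_ /= /andP[_ uD] _ <-]]; have /card_uniqP := uD.
  by rewrite size_map => <-; exact: max_card.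
case: (ex_maxnP exP ubP) => n /asboolP[D [rD uD ue sD]] maxn.
exists D; split=> // v.
have grow e u w : u \in p :: verts D -> w \notin p :: verts D -> joins e u w -> False.
  move=> uD' wD euw; have [D2 rD2 pD2] := rooted_grow rD uD' euw.
  suff : n.+1 <= n by rewrite ltnn.
  apply: maxn; apply/asboolP; exists D2.
  have pv : perm_eq (p :: verts D2) (w :: p :: verts D).
    have C : perm_eq ([:: p] ++ [:: w] ++ verts D) (w :: p :: verts D).
      by rewrite perm_catCA.
    apply: perm_trans C.
    by rewrite perm_cons; exact: (perm_map fst pD2).
  split=> //; last by rewrite (perm_size pD2) /= sD.
    by rewrite (perm_uniq pv) cons_uniq wD.
  rewrite (perm_uniq (perm_map snd pD2)) /= ue andbT.
  apply/negP => /mapP[[v' e'] vD /= eE]; rewrite -eE in vD.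
  have /andP[srcD tgtD] := rooted_ends rD vD.
  case/orP: euw => /andP[/eqP a /eqP b]; case/negP: wD.
    by rewrite -b.
  by rewrite -a.
suff E : [set w in p :: verts D] = [set: vert Q] by move/setP/(_ v): E; rewrite !inE.
apply: conn => [|e]; first by apply/set0Pn; exists p; rewrite inE mem_head.
rewrite !inE -!in_cons; apply/idP/idP => h; apply: contrapT => /negP h';
  by apply: (grow e _ _ h h'); rewrite /joins !eqxx ?orbT.
Qed.

End QuiverForests.

(** * The contraction determined by an embedding of forests *)

Section Contraction.
Variables (Q Q' : quiver) (rho : vert Q * edge Q -> vert Q' * edge Q' -> Prop).
Hypothesis rho_tgt : forall x y, rho x y -> (tgt x.2 == x.1) = (tgt y.2 == y.1).

Definition kept_edge (x : vert Q + edge Q) : option (edge Q) :=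
  if x is inr e then Some e else None.

(** The summand [inl] stands for collapsed edges and [inr] for kept ones. The list [N] is a
    parameter because the induction maps onto subforests. *)
Definition contracts (phi : vert Q' -> vert Q) (h : edge Q' -> vert Q + edge Q)
    (N : seq (vert Q * edge Q)) (y : vert Q' * edge Q') : Prop :=
  match h y.2 with
  | inl v => phi (src y.2) = v /\ phi (tgt y.2) = v
  | inr e => [/\ (phi y.1, e) \in N, rho (phi y.1, e) y,
                 phi (src y.2) = src e & phi (tgt y.2) = tgt e]
  end.

Lemma contracts_ext phi phi2 h h2 (N N2 : seq (vert Q * edge Q)) p' D' :
  rooted p' D' -> {in p' :: verts D', phi2 =1 phi} -> {in edges D', h2 =1 h} ->
  {subset N <= N2} -> (forall y, y \in nodes D' -> contracts phi h N y) ->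
  forall y, y \in nodes D' -> contracts phi2 h2 N2 y.
Proof.
move=> rD' pE hE NN2 ctr [v' e'] yD'; move: (ctr _ yD'); rewrite /contracts /=.
have /andP[sD tD] := rooted_ends rD' yD'.
have vD : v' \in p' :: verts D' by rewrite inE (mem_verts yD') orbT.
rewrite hE ?(mem_edges yD') // !pE //.
by case: (h e') => // e [/NN2].
Qed.

(** Induction along the embedding; whatever is skipped is sent to the current target root [p]. The
    last conclusion keeps track of order: the kept edges, read in preorder, become the edges of [D]
    in preorder. Both the bijection on edges and the monotonicity of leading terms rest on it. *)
Lemma contraction D' D p p' : embeds rho D D' -> rooted p D -> rooted p' D' ->
  uniq (p :: verts D) -> uniq (p' :: verts D') -> uniq (edges D') ->
  exists phi h, [/\ phi p' = p,
    forall y, y \in nodes D' -> contracts phi h (nodes D) y &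
    pmap (kept_edge \o h) (edges D') = edges D].
Proof.
have const B q q' : rooted q' B -> exists phi h, [/\ phi q' = q,
    forall y : vert Q' * edge Q', y \in nodes B -> contracts phi h [::] y &
    pmap (kept_edge \o h) (edges B) = [::]].
  by move=> _; exists (fun=> q), (fun=> inl q); split=> //; elim: (edges B).
elim: D' D p p' => [|[w f] c' IHc s' IHs] D p p' DD' rD rD'.
  by case: D DD' rD => // _ _ _ _ _; exact: const.
rewrite edges_node verts_node => uD uD' uE'.
have /and3P[/= fp rc rs] := rD'.
have [pw pc ps] : [/\ p' != w, p' \notin verts c' & p' \notin verts s'].
  by move: uD'; rewrite !cons_uniq inE !mem_cat !negb_or => /andP[/and3P[]].
have [uc us cs] : [/\ uniq (w :: verts c'), uniq (p' :: verts s') &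
    forall u, u \in p' :: verts s' -> u \notin w :: verts c'].
  move: uD'; rewrite !cons_uniq cat_uniq !mem_cat !negb_or.
  case/andP=> _ /and4P[/andP[wc ws] uc cs us]; split; rewrite /= ?wc ?ps //.
  move=> u; rewrite inE => /predU1P[->|us']; first by rewrite inE negb_or pw.
  rewrite inE negb_or; apply/andP; split; first by apply: contraNneq ws => <-.
  by move/hasPn: cs; apply.
have [fc fs ec es ecs] : [/\ f \notin edges c', f \notin edges s', uniq (edges c'),
    uniq (edges s') & forall e, e \in edges s' -> e \notin edges c'].
  move: uE'; rewrite cons_uniq cat_uniq mem_cat negb_or => /and4P[/andP[-> ->] -> + ->].
  by move/hasPn; split.
(* Two inductively given maps can be combined because [c'] with its root [w] shares no vertex with
   [s'] and its root [p']. *)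
pose glue (phi1 phi2 : vert Q' -> vert Q) u :=
  if u \in w :: verts c' then phi1 u else phi2 u.
pose hglue (h1 h2 : edge Q' -> vert Q + edge Q) a e :=
  if e \in edges c' then h1 e else if e == f then a else h2 e.
have glueP N N1 N2 phi1 phi2 h1 h2 a :
    phi2 p' = p -> {subset N1 <= N} -> {subset N2 <= N} ->
    (forall y, y \in nodes c' -> contracts phi1 h1 N1 y) ->
    (forall y, y \in nodes s' -> contracts phi2 h2 N2 y) ->
    contracts (glue phi1 phi2) (fun=> a) N (w, f) ->
  [/\ glue phi1 phi2 p' = p,
   forall y, y \in (w, f) :: nodes c' ++ nodes s' ->
     contracts (glue phi1 phi2) (hglue h1 h2 a) N y &
   pmap (kept_edge \o hglue h1 h2 a) (f :: edges c' ++ edges s') =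
   seq_of_opt (kept_edge a) ++ pmap (kept_edge \o h1) (edges c')
     ++ pmap (kept_edge \o h2) (edges s')].
  move=> p2 N1N N2N ctr1 ctr2 ctr; split.
  - by rewrite /glue (negbTE (cs _ _)) ?mem_head.
  - move=> y; rewrite inE mem_cat => /or3P[/eqP->|yc|ys].
    + by move: ctr; rewrite /contracts /= /hglue (negbTE fc) eqxx.
    + apply: (contracts_ext rc _ _ N1N ctr1 yc) => [u uc'|e ec'].
        by rewrite /glue uc'.
      by rewrite /hglue ec'.
    + apply: (contracts_ext rs _ _ N2N ctr2 ys) => [u us'|e es'].
        by rewrite /glue (negbTE (cs _ us')).
      rewrite /hglue (negbTE (ecs _ es')); case: eqP => // ef.
      by rewrite -ef es' in fs.
  - rewrite /= pmap_cat /hglue (negbTE fc) eqxx.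
    have -> : pmap (kept_edge \o hglue h1 h2 a) (edges c')
        = pmap (kept_edge \o h1) (edges c').
      by apply: eq_in_pmap => e ec'; rewrite /= /hglue ec'.
    have -> : pmap (kept_edge \o hglue h1 h2 a) (edges s')
        = pmap (kept_edge \o h2) (edges s').
      apply: eq_in_pmap => e es'; rewrite /= /hglue (negbTE (ecs _ es')).
      by case: eqP => // ef; rewrite -ef es' in fs.
    by case: (kept_edge a).
have wp (phi1 phi2 : vert Q' -> vert Q) : phi2 p' = p ->
    [/\ glue phi1 phi2 p' = p & glue phi1 phi2 w = phi1 w].
  by move=> p2; rewrite /glue (negbTE (cs _ (mem_head _ _))) mem_head.
have ends (phi : vert Q' -> vert Q) a b : phi p' = a -> phi w = b ->
    if tgt f == w then phi (src f) = a /\ phi (tgt f) = b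
    else phi (src f) = b /\ phi (tgt f) = a.
  move=> <- <-; case/orP: fp => /andP[/eqP-> /eqP->]; first by rewrite eqxx.
  by rewrite (negbTE pw).
have skip phi : phi p' = p -> phi w = p -> contracts phi (fun=> inl p) (nodes D) (w, f).
  by move=> pp pw'; rewrite /contracts /=; case: ifP (ends phi _ _ pp pw').
case: D DD' rD uD skip => [|x c s].
  move=> _ _ _ skip.
  have [phi1 [h1 [p1 ctr1 l1]]] := const c' p w rc.
  have [phi2 [h2 [p2 ctr2 l2]]] := const s' p p' rs.
  have [g1 g2] := wp phi1 phi2 p2.
  exists (glue phi1 phi2), (hglue h1 h2 (inl p)).
  have [|||a b c] := @glueP [::] [::] [::] phi1 phi2 h1 h2 (inl p) p2 _ _ ctr1 ctr2 => //.
    by apply: skip; rewrite ?g2.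
  by split=> //; rewrite [LHS]c l1 l2.
case=> [Dc|Ds|[xy cc ss]] rD uD skip.
- have [phi1 [h1 [p1 ctr1 l1]]] := IHc _ _ _ Dc rD rc uD uc ec.
  have [phi2 [h2 [p2 ctr2 l2]]] := const s' p p' rs.
  have [g1 g2] := wp phi1 phi2 p2.
  exists (glue phi1 phi2), (hglue h1 h2 (inl p)).
  have [|||a b c0] := @glueP (nodes (Node x c s)) (nodes (Node x c s)) [::]
    phi1 phi2 h1 h2 (inl p) p2 _ _ ctr1 ctr2 => //.
    by apply: skip; rewrite ?g2.
  by split=> //; rewrite [LHS]c0 l1 l2 cats0.
- have [phi1 [h1 [p1 ctr1 l1]]] := const c' p w rc.
  have [phi2 [h2 [p2 ctr2 l2]]] := IHs _ _ _ Ds rD rs uD us es.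
  have [g1 g2] := wp phi1 phi2 p2.
  exists (glue phi1 phi2), (hglue h1 h2 (inl p)).
  have [|||a b c0] := @glueP (nodes (Node x c s)) [::] (nodes (Node x c s))
    phi1 phi2 h1 h2 (inl p) p2 _ _ ctr1 ctr2 => //.
    by apply: skip; rewrite ?g2.
  by split=> //; rewrite [LHS]c0 l1 l2.
have /and3P[xp rc0 rs0] := rD.
move: uD; rewrite verts_node !cons_uniq inE !mem_cat !negb_or cat_uniq.
move=> /and3P[/and3P[px pc0 ps0] /andP[xc xs] /and3P[uc0 _ us0]].
have [|phi1 [h1 [p1 ctr1 l1]]] := IHc _ _ _ cc rc0 rc _ uc ec; first by rewrite /= xc.
have [|phi2 [h2 [p2 ctr2 l2]]] := IHs _ _ _ ss rs0 rs _ us es; first by rewrite /= ps0.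
have [g1 g2] := wp phi1 phi2 p2.
exists (glue phi1 phi2), (hglue h1 h2 (inr x.2)).
have [||| a b c0] := @glueP (nodes (Node x c s)) (nodes c) (nodes s)
  phi1 phi2 h1 h2 (inr x.2) p2 _ _ ctr1 ctr2.
- by move=> y yc; rewrite /= inE mem_cat yc orbT.
- by move=> y ys; rewrite /= inE mem_cat ys !orbT.
(* Equal orientations of [x.2] and [f] decide which of their ends is the parent; as [p] and [x.1]
   are distinct, the mismatched cases are contradictory. *)
- have := ends (glue phi1 phi2) _ _ g1 (etrans g2 p1).
  rewrite /contracts /= g2 p1 -surjective_pairing mem_head -(rho_tgt xy).
  case: ifP => tx [-> ->]; case/orP: xp => /andP[/eqP a /eqP b]; split=> //.
  + by rewrite a (eqP tx) in b *; rewrite b eqxx in px.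
  + by rewrite (eqP tx) in b; rewrite b eqxx in px.
  + by rewrite b eqxx in tx.
  + by rewrite b eqxx in tx.
by split=> //; rewrite [LHS]c0 l1 l2 edges_node.
Qed.

End Contraction.

Section PmapIndex.
Variables (T U : eqType) (F : T -> option U).

Lemma pmap_inj s x y a : uniq (pmap F s) -> x \in s -> y \in s ->
  F x = Some a -> F y = Some a -> x = y.
Proof.
elim: s => // z s IHs; rewrite /= !inE.
case Fz: (F z) => [c|] /=; last first.
  move=> us /predU1P[->|xs] /predU1P[->|ys] //; rewrite ?Fz // => Fx Fy; exact: IHs.
case/andP=> cs us /predU1P[->|xs] /predU1P[->|ys] // Fx Fy; last exact: IHs.
- by case/negP: cs; rewrite mem_pmap -Fz Fx -Fy map_f.
- by case/negP: cs; rewrite mem_pmap -Fz Fy -Fx map_f.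
Qed.

(** A partial map drops entries without reordering the others, so without repetitions in the output
    the order there can be pulled back. *)
Lemma pmap_index_lt s x y a b : uniq (pmap F s) -> x \in s -> y \in s ->
  F x = Some a -> F y = Some b -> index a (pmap F s) < index b (pmap F s) ->
  index x s < index y s.
Proof.
elim: s => // z s IHs; rewrite /= !inE ![z == _]eq_sym => us xs ys Fx Fy.
have [yz|yz] := eqVneq y z.
  by rewrite yz in Fy; rewrite Fy /= eqxx.
have [xz|xz] := eqVneq x z => //.
rewrite (negbTE xz) /= in xs; rewrite (negbTE yz) /= in ys.
case Fz: (F z) us => [c|] /=; last by move=> us; apply: IHs.
case/andP=> cs us; have nc u d : u \in s -> F u = Some d -> (c == d) = false.
  by move=> us' Fu; apply: contraNF cs => /eqP->; rewrite mem_pmap -Fu map_f.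
by rewrite (nc _ _ xs Fx) (nc _ _ ys Fy) !ltnS; apply: IHs.
Qed.

End PmapIndex.

(** * Labelled presentations of connected quivers *)

Section Presentations.
Variable Q : quiver.

(** The list [edges D ++ ex] serves twice: it separates tree edges from further edges, and it is the
    total order on edges behind leading terms. *)
Definition presents (r : vert Q) (D : forest (vert Q * edge Q))
    (ex : seq (edge Q)) : Prop :=
  [/\ rooted r D, uniq (r :: verts D), (forall v, v \in r :: verts D),
      uniq (edges D ++ ex) & forall e, e \in edges D ++ ex].

Variables (n k : nat) (b : n.-tuple (edge Q)) (ex : seq (edge Q)).

(* Vertices carry the labels of the spanning tree: the label of the node [(v, e)]
   records the positions [p] of the marked tuple [b] with [b_p = e], the
   orientation of [e], and the indices of the extra edges that start or end at [v].
   The label of the root records the marks on the extra edges. *)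
Definition ends_at v : {set 'I_k} * {set 'I_k} :=
  ([set j : 'I_k | omap (@src Q) (onth ex j) == Some v],
   [set j : 'I_k | omap (@tgt Q) (onth ex j) == Some v]).

Definition node_label (x : vert Q * edge Q) :
    ({set 'I_n} * bool * ({set 'I_k} * {set 'I_k}))%type :=
  ([set p : 'I_n | tnth b p == x.2], tgt x.2 == x.1, ends_at x.1).

Definition root_label (r : vert Q) :
    ('I_k.+1 * {set 'I_n * 'I_k} * ({set 'I_k} * {set 'I_k}))%type :=
  (inord (size ex),
   [set pj : 'I_n * 'I_k | onth ex pj.2 == Some (tnth b pj.1)], ends_at r).

End Presentations.

Lemma presentation_exists (R : realType) (Q : quiver) (r : vert Q) :
  quiver_connected R Q ->
  exists D ex, presents r D ex /\ size ex <= (genus Q).+1.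
Proof.
move=> Qc; have [D [rD uD cD uE]] :=
  @spanning_forest Q r (fun A => @connected_closed_verts R Q A Qc).
pose ex := [seq e <- enum (edge Q) | e \notin edges D].
have cE e : e \in edges D ++ ex by rewrite mem_cat mem_filter mem_enum andbT orbN.
have uE2 : uniq (edges D ++ ex).
  rewrite cat_uniq uE filter_uniq ?enum_uniq // andbT.
  by apply/hasPn => e; rewrite mem_filter => /andP[].
exists D, ex; split; first by split.
have sV : size (edges D) = #|vert Q|.-1.
  have <- : #|r :: verts D| = #|vert Q| by apply: eq_card => v; rewrite cD.
  by rewrite (card_uniqP uD) /= !size_map.
have sE : size (edges D) + size ex = #|edge Q|.
  rewrite -size_cat -(card_uniqP uE2); apply: eq_card => e; exact: cE.
(* Origin of the bound by the genus plus one: the rank of the boundary is estimated by the number of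
   vertices, while the tree has one edge fewer than that. *)
rewrite /genus mxrank_ker; have := rank_leq_col (cellular_boundary Q).
have : 0 < #|vert Q| by apply/card_gt0P; exists r.
move: sE; rewrite sV; move: (\rank _ : nat) => m.
move: (#|vert Q|) (#|edge Q|) (size ex) => v e s <- v0 mv.
case: v v0 mv => // v _ mv /=; rewrite -[X in X <= _](addKn v.+1 s).
apply: leq_trans (leq_sub2l (v.+1 + s) mv) _.
by rewrite addSn leq_subLR addnS ltnS -leq_subLR.
Qed.

Section FiberTree.
Variables (R : realType) (Q' Q : quiver) (phi : vert Q' -> vert Q).

(** Every vertex of the fibre except [rx] has its parent edge in the fibre, so the fibre is a tree
    rooted at [rx]. The depth in the whole tree still drops by one along each parent edge and can be
    reused. *)
Lemma fiber_directed_tree (r' : vert Q') D' (x : vert Q) (rx : vert Q')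
    (P : subquiver Q') : rooted r' D' -> uniq (r' :: verts D') ->
  (forall v, v \in r' :: verts D') ->
  (forall v, v \in sub_vert P = (phi v == x)) -> phi rx = x ->
  (phi r' = x -> rx = r') ->
  (forall v e, (v, e) \in nodes D' -> phi v = x -> v != rx -> e \in sub_edge P) ->
  (forall e, (rx, e) \in nodes D' -> e \notin sub_edge P) ->
  (forall e, e \in sub_edge P -> e \in edges D') ->
  directed_tree R P.
Proof.
move=> rD uD cD Pv rxx r'x vP rxP Pe.
have [depth _ depthP] := rooted_depth 0 rD uD.
have rxV : rx \in sub_vert P by rewrite Pv rxx.
have inP (v : vert P) : phi (val v) = x by apply/eqP; rewrite -Pv (valP v).
apply: (@rooted_directed_tree R P (exist _ rx rxV) (fun v => depth (val v))
  (fun v e => (val v, val e) \in nodes D')).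
- move=> v vr; have vr' : val v != rx by apply: contra vr => /eqP E; apply/eqP/val_inj.
  have := cD (val v); rewrite inE => /predU1P[E|/mapP[[v' e] vD /= E]].
    by case/eqP: vr'; rewrite E r'x // -E.
  subst v'; have eP := vP _ _ vD (inP v) vr'.
  by exists (exist _ e eP).
- move=> [e eP]; have /mapP[[v e'] vD /= E] := Pe _ eP; subst e'.
  have [q _ eqv] := rooted_joins rD vD.
  have vx : v \in sub_vert P.
    by case/orP: eqv => /andP[/eqP a /eqP b]; [rewrite -b sub_tgt|rewrite -a sub_src].
  exists (exist _ v vx) => //; apply: contraTneq eP => /(congr1 val) /= E; subst v.
  exact: rxP.
- move=> [v vV] [e eP] /= vD; have [q [_ eqv dv]] := depthP _ _ vD.
  have qV : q \in sub_vert P.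
    by case/orP: eqv => /andP[/eqP a /eqP b]; [rewrite -a sub_src|rewrite -b sub_tgt].
  by exists (exist _ q qV) => //; rewrite /joins -!val_eqE /=.
- move=> v e e' vD vD'; apply: val_inj.
  have /andP[_ uv] := uD.
  by have [] := uniq_map_inj uv vD vD' erefl.
Qed.

End FiberTree.

(** * From embeddings of labelled trees to minor morphisms *)

Section MinorOfEmbedding.
Variables (R : realType) (Q' Q : quiver) (n k : nat).
Variables (b' : n.-tuple (edge Q')) (b : n.-tuple (edge Q)).
Variables (r' : vert Q') (r : vert Q).
Variables (D' : forest (vert Q' * edge Q')) (D : forest (vert Q * edge Q)).
Variables (ex' : seq (edge Q')) (ex : seq (edge Q)).
Hypotheses (prD' : presents r' D' ex') (prD : presents r D ex).
Hypotheses (exk' : size ex' <= k) (exk : size ex <= k).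
Hypothesis roots : root_label k b ex r = root_label k b' ex' r'.
Hypothesis emb : embeds (fun x y => node_label k b ex x = node_label k b' ex' y) D D'.

Definition edge_of (x : elt Q) : option (edge Q) :=
  if x is Some (inr e) then Some e else None.

Lemma minor_of_embedding : exists phi : minor R Q' Q,
  (forall p, phi (of_edge (tnth b' p)) = of_edge (tnth b p)) /\
  pmap (fun e => edge_of (phi (of_edge e))) (edges D' ++ ex') = edges D ++ ex.
Proof.
have [rD' uD' cD' uE' cE'] := prD'; have [rD uD cD uE cE] := prD.
have uD'E : uniq (edges D') by move: uE'; rewrite cat_uniq => /and3P[].
have uDE : uniq (edges D) by move: uE; rewrite cat_uniq => /and3P[].
have [|phi [h [pr ctr hE]]] := contraction _ emb rD rD' uD uD' uD'E.
  by move=> x y [_ + _].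
have sz : size ex' = size ex.
  by move: roots => [/(congr1 val) + _ _]; rewrite /= !inordK ?ltnS.
have up u f : (u, f) \in nodes D -> exists v' f', [/\ (v', f') \in nodes D', phi v' = u,
    h f' = inr f & node_label k b ex (u, f) = node_label k b' ex' (v', f')].
  move=> uf; have : f \in pmap (@kept_edge Q \o h) (edges D').
    by rewrite hE (mem_edges uf).
  rewrite mem_pmap => /mapP[f' /mapP[[v' g] vD' /= ->]].
  case hf: (h g) => [|f0] //= [E]; subst f0; exists v', g.
  have := ctr _ vD'; rewrite /contracts /= hf => -[vfD lab _ _].
  have vu : phi v' = u by have [] := uniq_map_inj uDE vfD uf erefl.
  by rewrite -vu; split.
(* Ends are found through labels: each vertex of [Q] has a preimage with the same [ends_at], which
   tells whether the [j]-th extra edge starts or ends there. *)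
have extra j e' e : onth ex' j = Some e' -> onth ex j = Some e ->
    phi (src e') = src e /\ phi (tgt e') = tgt e.
  move=> je' je; have jk : j < k by apply: leq_trans exk; rewrite -onthTE je.
  have key u v' : ends_at k ex u = ends_at k ex' v' ->
      (src e = u -> src e' = v') /\ (tgt e = u -> tgt e' = v').
    move=> [/setP/(_ (Ordinal jk)) + /setP/(_ (Ordinal jk))].
    rewrite !inE /= je je' /= !(inj_eq Some_inj) => E1 E2.
    by split=> /eqP; rewrite ?E1 ?E2 => /eqP.
  have img u : exists2 v', phi v' = u & ends_at k ex u = ends_at k ex' v'.
    have := cD u; rewrite inE => /predU1P[->|/mapP[[u' f] uf /= ->]].
      by exists r' => //; exact: (congr1 snd roots).
    have [v' [f' [_ <- _ lab]]] := up _ _ uf; exists v' => //.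
    exact: (congr1 snd lab).
  split.
    by have [v' pv' /key[/(_ erefl) -> _]] := img (src e).
  by have [v' pv' /key[_ /(_ erefl) ->]] := img (tgt e).
(* Extra edges are never contracted: each goes to the one in the same position, which exists because
   the two lists have equal length. *)
pose Phi (x : elt Q') : elt Q := match x with
  | None => None
  | Some (inl v) => of_vert (phi v)
  | Some (inr e) =>
      if e \in edges D' then Some (h e) else omap inr (onth ex (index e ex'))
  end.
have PhiE : pmap (fun e => edge_of (Phi (of_edge e))) (edges D' ++ ex') = edges D ++ ex.
  rewrite pmap_cat -hE; congr (_ ++ _).
    by apply: eq_in_pmap => e eD /=; rewrite eD; case: (h e).
  have [exE|[e0 e0x]] : ex = [::] \/ exists e0, e0 \in ex.
  - by case: (ex) => [|e0 s]; [left|right; exists e0; rewrite mem_head].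
  - by move: sz; rewrite exE; case: (ex').
  have uex' : uniq ex' by move: uE'; rewrite cat_uniq => /and3P[].
  have disj e : e \in ex' -> e \notin edges D'.
    by move: uE'; rewrite cat_uniq => /and3P[_ /hasPn + _]; apply.
  transitivity (pmap (fun e => Some (nth e0 ex (index e ex'))) ex').
    apply: eq_in_pmap => e ee' /=; rewrite (negbTE (disj _ ee')).
    have : onth ex (index e ex') by rewrite onthTE -sz index_mem.
    by case E: (onth ex _) => [f|] //= _; rewrite (onth_nth e0 _ _ _ E).
  rewrite -[RHS]map_id -[in RHS](_ : map (fun e => nth e0 ex (index e ex')) ex' = ex).
    by rewrite map_id; elim: (ex') => //= e s ->.
  apply: (@eq_from_nth _ e0); rewrite size_map // => i ilt.
  have [e1 _] : exists e1, e1 \in ex'.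
    by case: (ex') ilt => // e1 ? _; exists e1; rewrite mem_head.
  by rewrite (nth_map e1) // index_uniq.
have PhiT (e' : edge Q') :
    (exists x, Phi (of_edge e') = of_vert x /\ e' \in edges D' /\ h e' = inl x) \/
    exists2 e, Phi (of_edge e') = of_edge e &
      phi (src e') = src e /\ phi (tgt e') = tgt e.
  rewrite /Phi /=; case: ifP => eD'.
    case/mapP: eD' => -[v' g] vD' /= E; subst g; have := ctr _ vD'; rewrite /contracts /=.
    case hE': (h e') => [x|e] c; [left; exists x|right; exists e => //].
      by split=> //; rewrite (mem_edges vD').
    by case: c.
  have := cE' e'; rewrite mem_cat eD' /= => ee'.
  have : onth ex (index e' ex') by rewrite onthTE -sz index_mem.
  case E: (onth ex _) => [f|] //= _; right; exists f => //.
  by apply: extra E; rewrite onthE (nth_map e') ?index_mem // nth_index.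
have PhiI e : exists2 e', e' \in edges D' ++ ex' & Phi (of_edge e') = of_edge e.
  have := cE e; rewrite -PhiE mem_pmap => /mapP[e' e'D E]; exists e' => //.
  by case: (Phi (of_edge e')) E => [[x|f]|] //= [->].
have minorPhi : is_minor R Phi.
  split.
  - split=> //; apply/seteqP; split=> [_ [_ [v' _ <-] <-]|_ [v _ <-]].
      by exists (phi v').
    have := cD v; rewrite inE => /predU1P[->|/mapP[[u f] uf /= ->]].
      by exists (of_vert r'); [exists r'|rewrite /= pr].
    by have [v' [_ [_ <- _ _]]] := up _ _ uf; exists (of_vert v') => //; exists v'.
  - move=> e' _; have [[x [-> [eD hx]]]|[e -> [es et]]] := PhiT e'; [left|right].
      exists x; have /mapP[[v' g] vD' /= E] := eD; subst g.
      by have := ctr _ vD'; rewrite /contracts /= hx => -[-> ->].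
    by exists e; rewrite /= es et.
  - move=> e; have [e' e'D E] := PhiI e.
    exists (of_edge e'); split=> // -[[v'|f]|] //= Ef; congr of_edge.
    (* The preimage of an edge is unique because [edges D ++ ex], the list of values of [Phi], has
       no repetitions. *)
    apply: (pmap_inj (F := fun e => edge_of (Phi (of_edge e))) _ e'D (cE' f) (a := e)).
    + by rewrite PhiE.
    + exact: (congr1 edge_of E).
    + exact: (congr1 edge_of Ef).
  - move=> x.
    have stP (e : edge Q') : e \in [set e | Phi (of_edge e) == of_vert x] ->
        [/\ e \in edges D', h e = inl x, phi (src e) = x & phi (tgt e) = x].
      rewrite inE => /eqP ex0.
      have [[y [E [eD hx]]]|[f E _]] := PhiT e; last by rewrite E in ex0.
      move: E; rewrite ex0 => -[xy]; subst y; have /mapP[[v' g] vD' /= E] := eD; subst g.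
      by have := ctr _ vD'; rewrite /contracts /= hx => -[-> ->].
    have s1 (e : edge Q') : e \in [set e | Phi (of_edge e) == of_vert x] ->
        src e \in [set w | phi w == x] by move=> /stP[_ _ <- _]; rewrite inE.
    have s2 (e : edge Q') : e \in [set e | Phi (of_edge e) == of_vert x] ->
        tgt e \in [set w | phi w == x] by move=> /stP[_ _ _ <-]; rewrite inE.
    exists (Subquiver s1 s2); split=> [w|e|] /=; rewrite ?inE //.
    (* The fibre over [r] is rooted at [r']. Over any other [x] the root is the vertex whose parent
       edge is kept and maps to the parent edge of [x]. *)
    have [rx [rxx rx1 rx2 rx3]] : exists rx, [/\ phi rx = x, (phi r' = x -> rx = r'),
       (forall v e, (v, e) \in nodes D' -> phi v = x -> v != rx -> h e = inl x) &
       (forall e, (rx, e) \in nodes D' -> h e <> inl x)].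
      have [xr|xr] := eqVneq x r.
        have nr v e : (v, e) \in nodes D' -> phi v = x -> h e = inl x.
          move=> vD; have := ctr _ vD; rewrite /contracts /=.
          case hE': (h e) => [y|f].
            move=> [sy ty] <-; have [q _] := rooted_joins rD' vD.
            by case/orP=> /andP[/eqP a /eqP c]; congr inl; rewrite -?a -?c.
          by move=> [vf _ _ _] vx; case/andP: uD; rewrite -xr -vx (mem_verts vf).
        exists r'; split=> // [|v e vD vx _|e rD'e]; [by rewrite pr xr|exact: nr vx|].
        by case/andP: uD'; rewrite (mem_verts rD'e).
      have := cD x; rewrite inE (negbTE xr) => /mapP[[u f] uf /= xu]; subst u.
      have [rx [f' [rxD rxx hf _]]] := up _ _ uf; exists rx; split=> //.
      + by move=> E; case/eqP: xr; rewrite -E pr.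
      + move=> v e vD vx; have := ctr _ vD; rewrite /contracts /=.
        case he: (h e) => [y|f2].
          move=> [sy ty] _; have [q _] := rooted_joins rD' vD.
          by case/orP=> /andP[/eqP a /eqP c]; congr inl; rewrite -vx -?a -?c.
        move=> [vf _ _ _] /eqP[].
        have uDv : uniq (verts D) by case/andP: uD.
        have ff : f2 = f by rewrite vx in vf; have [] := uniq_map_inj uDv vf uf erefl.
        have ee : e = f'.
          apply: (pmap_inj (F := @kept_edge Q \o h) (s := edges D') (a := f)).
          * by rewrite hE.
          * exact: mem_edges vD.
          * exact: mem_edges rxD.
          * by rewrite /= he ff.
          * by rewrite /= hf.
        by subst e; have [] := uniq_map_inj uD'E vD rxD erefl.
      + move=> e rxe; have uDv : uniq (verts D') by case/andP: uD'.
        have -> : e = f' by have [] := uniq_map_inj uDv rxe rxD erefl.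
        by rewrite hf.
    apply: (fiber_directed_tree R (phi := phi) (x := x) rD' uD' cD' _ rxx rx1)
      => /= [v|v e vD vx vr|e eD|e].
    + by rewrite inE.
    + by rewrite inE /= (mem_edges vD) (rx2 _ _ vD vx vr).
    + by apply/negP => /stP[_ + _ _]; exact: rx3.
    + by case/stP.
exists (Minor minorPhi); split=> // p.
(* Marks on tree edges are read off from the labels of nodes, marks on extra edges from the label of
   the root. *)
rewrite /= /Phi /=; have := cE (tnth b p); rewrite mem_cat.
case/orP=> [/mapP[[u f] uf /= bf]|bx].
  have [v' [f' [vD' _ hf' lab]]] := up _ _ uf.
  have := congr1 (fun x : {set 'I_n} * bool * ({set 'I_k} * {set 'I_k}) => p \in x.1.1) lab.
  rewrite /= !inE bf eqxx => /esym/eqP->.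
  by rewrite (mem_edges vD') hf'.
have jx : index (tnth b p) ex < size ex by rewrite index_mem.
have jk := leq_trans jx exk.
have jE : onth ex (index (tnth b p) ex) = Some (tnth b p).
  by rewrite onthE (nth_map (tnth b p)) // nth_index.
have := congr1 (fun x : 'I_k.+1 * {set 'I_n * 'I_k} * ({set 'I_k} * {set 'I_k}) =>
  (p, Ordinal jk) \in x.1.2) roots.
rewrite /= !inE /= jE eqxx => /esym/eqP jE'.
have jx' : index (tnth b p) ex < size ex' by rewrite sz.
have b'x : tnth b' p \in ex' by apply/onthP; exists (index (tnth b p) ex).
move: uE'; rewrite cat_uniq => /and3P[_ /hasPn/(_ _ b'x) /negbTE-> uex'].
have nE := onth_nth (tnth b' p) _ _ _ jE'.
by have := index_uniq (tnth b' p) jx' uex'; rewrite nE => ->; rewrite jE.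
Qed.

End MinorOfEmbedding.

(** * Reduction of cycles *)

Section DirectSum.
Local Open Scope ring_scope.
Variables (R : realType) (g : nat) (M : quiver_module R g).

Definition single_coord (Q0 : quiver_le R g) (x : M Q0) (Q : quiver_le R g) : M Q :=
  match pselect (Q0 = Q) with
  | left E => eq_rect Q0 (fun Q => M Q) x Q E
  | right _ => 0
  end.

Lemma single_finite (Q0 : quiver_le R g) (x : M Q0) :
  exists (n : nat) (s : 'I_n -> quiver_le R g),
    forall Q, single_coord x Q <> 0 -> exists j, Q = s j.
Proof.
exists 1%N, (fun=> Q0) => Q; rewrite /single_coord.
by case: pselect => [E _|_ []] //; exists ord0.
Qed.

Definition single (Q0 : quiver_le R g) (x : M Q0) : direct_sum M :=
  DirectSum (single_finite x).

Lemma single_id (Q0 : quiver_le R g) (x : M Q0) : single x Q0 = x.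
Proof.
rewrite /= /single_coord; case: pselect => // E.
by rewrite (Prop_irrelevance E erefl).
Qed.

Lemma finitely_generatedI n (q : 'I_n -> quiver_le R g) (x : forall j, M (q j)) :
  (forall N : submodule M, (forall j, mem_sub N (x j)) ->
    forall (Q : quiver_le R g) (y : M Q), mem_sub N y) ->
  finitely_generated M.
Proof.
move=> gen; exists n, (fun j => single (x j)) => N cN; apply: gen => j.
by have := cN j (q j); rewrite single_id.
Qed.

Lemma mem_subD (N : submodule M) Q (x y : M Q) :
  mem_sub N x -> mem_sub N y -> mem_sub N (x + y).
Proof.
move=> xN yN; rewrite -[y]opprK; apply: mem_subB => //.
by rewrite -sub0r; apply: mem_subB => //; exact: mem_sub0.
Qed.

End DirectSum.

Section Lex.
Local Open Scope order_scope.

Lemma lexi_map (T U : eqType) (f : T -> nat) (h : U -> nat) (l : T -> U) (s t : seq T) :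
  (forall a b, (h (l a) <= h (l b))%N = (f a <= f b)%N) ->
  ((map (h \o l) s : seqlexi nat) <= map (h \o l) t) =
  ((map f s : seqlexi nat) <= map f t).
Proof.
by move=> hl; elim: s t => [|a s IHs] [|b t] //=; rewrite !lexi_cons IHs !leEnat !hl.
Qed.

End Lex.

Section Chains.
Local Open Scope ring_scope.
Variables (S T : finType) (K : complex S) (L : complex T) (f : S -> T).
Hypothesis fKL : simplicial K L f.

Lemma chain_map_eval n (c : chain K n) (y : osimplex L n) :
  chain_map fKL c y = \sum_(x | osimplex_map fKL x == y) c x.
Proof.
rewrite /chain_map /lin_ext sum_ffunE [RHS]big_mkcond; apply: eq_bigr => x _.
by rewrite ffunMzE ffunE eq_sym; case: eqP => _; rewrite ?intz ?mul0rz.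
Qed.

Lemma osimplex_map_inj n : injective f -> injective (@osimplex_map S T K L f fKL n).
Proof.
move=> fi x y /(congr1 val) E; apply: val_inj; apply: eq_from_tnth => i.
by have := congr1 (fun t : n.+1.-tuple T => tnth t i) E; rewrite /= !tnth_mktuple => /fi.
Qed.

(** Distinct ordered simplices stay distinct, so coefficients are carried along without
    cancellation. *)
Lemma chain_map_at n (c : chain K n) (x : osimplex K n) : injective f ->
  chain_map fKL c (osimplex_map fKL x) = c x.
Proof.
move=> fi; rewrite chain_map_eval (big_pred1 x) // => y.
by rewrite (inj_eq (osimplex_map_inj fi)).
Qed.

Lemma chain_map_supp n (c : chain K n) (y : osimplex L n) :
  chain_map fKL c y != 0 -> exists2 x, osimplex_map fKL x = y & c x != 0.
Proof.
rewrite chain_map_eval => nz; apply: contrapT => no; case/eqP: nz.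
rewrite big1 // => x /eqP xy; apply/eqP; apply: contrapT => /negP cx.
by apply: no; exists x.
Qed.

End Chains.

(** * Leading terms and their behaviour under minor morphisms *)

Section Groebner.
Local Open Scope ring_scope.
Variables (R : realType) (g i : nat).
Let k := g.+1.
Let X (Q : quiver_le R g) := multipath_complex Q.

(** The lexicographic order on keys compares ordered simplices; the list [es] supplies the order on
    edges and will be [edges D ++ ex]. *)
Definition key (Q : quiver) (es : seq (edge Q))
    (y : osimplex (multipath_complex Q) i) : seqlexi nat :=
  map (index^~ es) (val y).

Definition leads (Q : quiver) (es : seq (edge Q)) (c : chain (multipath_complex Q) i)
    (y : osimplex (multipath_complex Q) i) : Prop :=
  c y != 0 /\ forall y', c y' != 0 -> (key es y' <= key es y)%O.

Definition code_of (Q : quiver) r D ex (c : chain (multipath_complex Q) i) y :=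
  (root_label k (val y) ex r, forest_map (node_label k (val y) ex) D, `|c y|%N).

Lemma key_inj (Q : quiver) (es : seq (edge Q)) :
  (forall e, e \in es) -> injective (key es).
Proof.
move=> ces y y' E; apply: val_inj; apply: eq_from_tnth => j.
have := congr1 (fun s : seq nat => nth 0%N s j) E.
rewrite /key !(nth_map (tnth (val y) j)) ?size_tuple // -!tnth_nth.
exact: (index_inj (tnth (val y) j) (ces _) (ces _)).
Qed.

Lemma key_osimplex_map (Q Q' : quiver) (f : edge Q -> edge Q') fS es'
    (x : osimplex (multipath_complex Q) i) :
  key es' (@osimplex_map _ _ _ (multipath_complex Q') f fS i x) =
  map (index^~ es' \o f) (val x).
Proof.
rewrite map_comp; congr map.
rewrite (_ : val _ = map_tuple f (val x)) //.
by apply: eq_from_tnth => j; rewrite tnth_mktuple tnth_map.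
Qed.

(** The edges of [Q] kept by [phi] appear in the order of the edges of [Q0], so [edge_lift] is
    strictly increasing and preserves the comparison of keys. The marks in the labels make it carry
    [y0] to [y]. *)
Lemma leading_term_push (Q Q0 : quiver_le R g) r D ex r0 D0 ex0
    (c : cycles (X Q) i) y (c0 : cycles (X Q0) i) y0 :
  presents r D ex -> presents r0 D0 ex0 -> (size ex <= k)%N -> (size ex0 <= k)%N ->
  leads (edges D0 ++ ex0) (val c0) y0 ->
  code_le (code_of r0 D0 ex0 (val c0) y0) (code_of r D ex (val c) y) ->
  exists phi : minor R Q Q0,
    val (Defs.cycle_map (edge_lift_simplicial phi) c0) y = val c0 y0 /\
    leads (edges D ++ ex) (val (Defs.cycle_map (edge_lift_simplicial phi) c0)) y.
Proof.
move=> pr pr0 exk exk0 [nz0 max0] [/= roots emb _].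
have [phi [phiE pmapE]] := minor_of_embedding R pr pr0 exk exk0 roots (embeds_map emb).
exists phi; set fS := edge_lift_simplicial phi.
have inj : injective (edge_lift phi).
  by move=> e f ef; have := edge_liftE phi e; rewrite ef edge_liftE => -[].
have yE : osimplex_map fS y0 = y.
  apply: val_inj; apply: eq_from_tnth => p; rewrite tnth_mktuple.
  exact: edge_lift_unique (phiE p).
have val_y : val (Defs.cycle_map fS c0) y = val c0 y0 by rewrite -yE; exact: chain_map_at.
split=> //; split; first by rewrite val_y.
move=> y' /chain_map_supp[x <- /max0]; rewrite -yE !key_osimplex_map.
have [_ _ _ uE cE] := pr; have [_ _ _ uE0 cE0] := pr0.
have ilt a b : (index a (edges D0 ++ ex0) < index b (edges D0 ++ ex0))%N ->
    (index (edge_lift phi a) (edges D ++ ex) < index (edge_lift phi b) (edges D ++ ex))%N.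
  by rewrite -pmapE; apply: pmap_index_lt; rewrite ?pmapE ?cE // edge_liftE.
rewrite (@lexi_map _ _ (index^~ (edges D0 ++ ex0)) (index^~ (edges D ++ ex))) // => a b.
apply/idP/idP => [|le]; first by apply: contraTT; rewrite -!ltnNge; exact: ilt.
have [/ilt/ltnW//|] := ltnP (index a (edges D0 ++ ex0)) (index b (edges D0 ++ ex0)).
by move=> ge; rewrite (index_inj a (cE0 a) (cE0 b)) //; apply/eqP; rewrite eqn_leq le.
Qed.

Section Reduction.
Variables (Q : quiver_le R g) (es : seq (edge Q)).
Hypothesis ces : forall e, e \in es.

(** Position in the finite order of keys, a natural number on which to do induction. *)
Definition key_rank (y : osimplex (X Q) i) := #|[set z | (key es z < key es y)%O]|.

Lemma key_rank_lt y y' : (key es y < key es y')%O -> (key_rank y < key_rank y')%N.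
Proof.
move=> lt; apply/proper_card/properP; split; last first.
  by exists y; rewrite !inE ?ltxx.
by apply/fintype.subsetP => z; rewrite !inE => /lt_trans; apply.
Qed.

Lemma key_rank_le y y' : (key_rank y <= key_rank y')%N = (key es y <= key es y')%O.
Proof.
apply/idP/idP => [|].
  by apply: contraTT; rewrite -ltNge -ltnNge; exact: key_rank_lt.
by rewrite le_eqVlt => /predU1P[/(key_inj ces) -> //|/key_rank_lt/ltnW].
Qed.

Lemma key_rank_inj : injective key_rank.
Proof.
move=> y y' E; apply: (key_inj ces); apply/eqP.
by rewrite eq_le -!key_rank_le E leqnn.
Qed.

Variable N : submodule (multipath_homology R g i).
Let NC (z : cycles (X Q) i) := @mem_sub _ _ _ N Q (homology_class z).

(** Double induction, on a bound [m] for the ranks in the support and on a bound [a] for the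
    absolute value of the coefficient at rank [m]. Adding or subtracting [w], according to the
    signs, lowers that absolute value because [w] has a nonzero coefficient no larger than that of
    [z], and it creates no term above [y]. *)
Lemma cycle_reduction :
  (forall (z : cycles (X Q) i) y, leads es (val z) y -> exists2 w, NC w &
    leads es (val w) y /\ (`|val w y| <= `|val z y|)%N) ->
  forall z, NC z.
Proof.
move=> red.
have NC0 : NC 0 by rewrite /NC /homology_class raddf0; exact: mem_sub0.
have NCD a b : NC a -> NC b -> NC (a + b).
  by rewrite /NC /homology_class raddfD; exact: mem_subD.
have NCB a b : NC a -> NC b -> NC (a - b).
  by rewrite /NC /homology_class raddfB; exact: mem_subB.
suff main m (z : cycles (X Q) i) : (forall y, val z y != 0 -> (key_rank y < m)%N) -> NC z.
  move=> z; apply: (main (\max_y key_rank y).+1) => y _; rewrite ltnS.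
  exact: leq_bigmax.
elim: m z => [|m IHm] z zm.
  suff -> : z = 0%R by [].
  by apply: val_inj; apply/ffunP => y; rewrite ffunE; apply/eqP; apply: contraT => /zm.
suff inner a : forall z : cycles (X Q) i,
    (forall y, val z y != 0 -> (key_rank y < m.+1)%N) ->
    (forall y, key_rank y = m -> (`|val z y| < a)%N) -> NC z.
  apply: (inner (\max_y `|val z y|).+1) => // y _; rewrite ltnS.
  exact: (leq_bigmax (F := fun y => `|val z y|%N)).
elim: a {z zm} => [|a IHa] z zm za.
  by apply: IHm => y zy; rewrite ltn_neqAle -ltnS zm // andbT; apply/eqP => /za.
have [[y zy ym]|no] := pselect (exists2 y, val z y != 0 & key_rank y = m); last first.
  apply: IHm => y zy; rewrite ltn_neqAle -ltnS zm // andbT; apply/eqP => ym.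
  by apply: no; exists y.
have [|w wN [[wy wlead] wz]] := red z y.
  by split=> // y' zy'; rewrite -key_rank_le ym -ltnS zm.
have step (z' : cycles (X Q) i) :
    (forall y', val z' y' != 0 -> val z y' != 0 \/ val w y' != 0) ->
    (`|val z' y| < `|val z y|)%N -> NC z'.
  move=> z'E z'y; apply: IHa => [y' /z'E[/zm//|/wlead]|y' y'm].
    by rewrite -key_rank_le ym ltnS.
  have -> : y' = y by apply: key_rank_inj; rewrite y'm ym.
  exact: leq_trans z'y (za y ym).
have valD (a1 a2 : cycles (X Q) i) y' : val (a1 + a2) y' = val a1 y' + val a2 y'.
  by rewrite raddfD ffunE.
have valB (a1 a2 : cycles (X Q) i) y' : val (a1 - a2) y' = val a1 y' - val a2 y'.
  by rewrite raddfB !ffunE.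
have [sg|sg] := eqVneq (0 < val z y) (0 < val w y).
- rewrite -(subrK w z); apply: NCD => //; apply: step => [y'|]; rewrite valB.
    by have [->|] := eqVneq (val z y') 0; [rewrite sub0r oppr_eq0; right|left].
  by move: zy wy wz sg; move: (val z y : int) (val w y : int) => u v; lia.
- rewrite -(addrK w z); apply: NCB => //; apply: step => [y'|]; rewrite valD.
    by have [->|] := eqVneq (val z y') 0; [rewrite add0r; right|left].
  by move: zy wy wz sg; move: (val z y : int) (val w y : int) => u v; lia.
Qed.

End Reduction.

Lemma homology_class_surj (Q : quiver) (h : homology (multipath_complex Q) i) :
  exists z, homology_class z = h.
Proof. by exists (repr h); exact: reprK. Qed.

End Groebner.

Theorem proposition4p6 (R : realType) (i g : nat) :
  finitely_generated (multipath_homology R g i).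
Proof.
(* The codes of leading terms of all cycles on all quivers, for all presentations; the label sets
   depend only on [i] and [g], so [code_basis] applies. *)
pose good (Q : quiver_le R g) (c : cycles (multipath_complex Q) i) a := exists r D ex y,
  [/\ presents r D ex, (size ex <= g.+1)%N, leads (edges D ++ ex) (val c) y &
   a = code_of g r D ex (val c) y].
have [m [w [wS wP]]] := code_basis (fun a => exists Q c, @good Q c a).
have [q qP] := choice wS.
pose c j := sval (cid (qP j)); have cP j := svalP (cid (qP j)).
apply: (@finitely_generatedI _ _ (multipath_homology R g i) m q
  (fun j => homology_class (c j))).
move=> N NP Q h; have [z <-] := homology_class_surj h.
(* The empty quiver counts as connected, and has no spanning tree. *)
have [r|noV] := pickP (fun v : vert Q => true); last first.
  suff -> : z = 0%R by rewrite /homology_class raddf0; exact: mem_sub0.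
  apply: val_inj; apply/ffunP => y; exfalso.
  by have := noV (src (tnth (val y) ord0)).
move=> _; have [D [ex [pr exk]]] := presentation_exists r (@quiver_le_connected R g Q).
have {}exk : (size ex <= g.+1)%N by apply: leq_trans exk _; rewrite ltnS quiver_le_genus.
have [_ _ _ _ cE] := pr.
apply: (cycle_reduction cE) => {}z y zy.
have [|j jle] := wP (code_of g r D ex (val z) y); first by exists Q, z, r, D, ex, y.
have [r0 [D0 [ex0 [y0 [pr0 exk0 lead0 wE]]]]] := cP j.
rewrite wE in jle.
have [phi [val_y lead]] := leading_term_push pr pr0 exk exk0 lead0 jle.
exists (Defs.cycle_map (edge_lift_simplicial phi) (c j)).
  by rewrite -homology_mapE; exact: (mem_sub_map phi (NP j)).
(* The third component of the code order bounds the leading coefficient of the generator by that of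
   [z]. *)
by split=> //; rewrite val_y; case: jle.
Qed.
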